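(* Let $Q$ be a quiver, and let $A=\tilde A/\tilde B$ be the $\mathbb{C}[\mathrm{h}]$-module of heighted links in $\overline{Q}$ modulo the relations defined in the context. Then the canonical projection $\tilde\pi:\tilde A\to SL[\mathrm{h}]$ obtained by forgetting the heights descends to an isomorphism $A\to SL[\mathrm{h}]$ of free $\mathbb{C}[\mathrm{h}]$-modules.
   Context: $Q$ is a quiver with vertex set $I$ (loops and multiple edges allowed); $Q$ also denotes its set of edges. Each edge $e$ has source $e_s$ and target $e_t$. The double quiver $\overline{Q}$ has vertex set $I$ and edges $\{e,e^*\mid e\in Q\}$ with $e^*_s=e_t$, $e^*_t=e_s$; put $(e^* )^*=e$. For $f,g\in\overline{Q}$ let $[e,e^*]=1$, $[e^*,e]=-1$ for $e\in Q$, and $[f,g]=0$ if $f\neq g^*$. $\mathrm{h}$ is a formal parameter. $L$ is the complex vector space with basis consisting of the vertices $v\in I$ and the closed paths $a_1\cdots a_k$ ($k\ge1$, $a_i\in\overline{Q}$) of $\overline{Q}$ up to cyclic rotation. $SL[\mathrm{h}]=S(L)\otimes_{\mathbb{C}}\mathbb{C}[\mathrm{h}]$, where $S(L)=\bigoplus_{n\ge0}S^nL$; the symmetric product is written $\&$. **Heighted links.** A heighted link is a formal expression $$X=(a_{1,1},h_{1,1})\cdots(a_{1,l_1},h_{1,l_1})\,\&\,\cdots\,\&\,(a_{k,1},h_{k,1})\cdots(a_{k,l_k},h_{k,l_k})\,\&\,v_1\,\&\cdots\&\,v_m$$ with $k,m\ge0$, $l_i\ge1$, where each $a_{i,1}\cdots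 a_{i,l_i}$ is a closed path in $\overline{Q}$ (the target of each arrow is the source of the next, cyclically), the heights $h_{i,j}\in\mathbb{N}$ are pairwise distinct, and $v_1,\dots,v_m\in I$. Each word is taken up to cyclic rotation, the components separated by $\&$ are unordered (symmetric product), and two links that differ by replacing the heights by other heights in the same relative order are identified. $\tilde A$ is the free $\mathbb{C}[\mathrm{h}]$-module on the heighted links. The map $\tilde\pi:\tilde A\to SL[\mathrm{h}]$ is the $\mathbb{C}[\mathrm{h}]$-linear map sending $X$ to $a_{1,1}\cdots a_{1,l_1}\&\cdots\&a_{k,1}\cdots a_{k,l_k}\&v_1\&\cdots\&v_m$. Second indices $j$ of $(i,j)$ are read modulo $l_i$. A vertex written in front of a possibly empty word means: if the word is empty, it is that vertex idempotent; otherwise it is omitted. **Relations.** Let $X$ be a heighted link and $(i,j)\ne(i',j')$ with $h_{i,j}<h_{i',j'}$ and no height of $X$ strictly between. Let $X'$ be $X$ with the heights $h_{i,j}$ and $h_{i',j'}$ interchanged. If $i\neq i'$, let $X''$ be obtained from $X$ by replacing the components $i$ and $i'$ by the single component $$[a_{i,j},a_{i',j'}]\,(a_{i,j})_t\,(a_{i,j+1},h_{i,j+1})\cdots(a_{i,j-1},h_{i,j-1})(a_{i',j'+1},h_{i',j'+1})\cdots(a_{i',j'-1},h_{i',j'-1}).$$ If $i=i'$, let $X''$ be obtained by replacing component $i$ by the two components $$[a_{i,j},a_{i,j'}]\,(a_{i,j'})_t\,(a_{i,j'+1},h_{i,j'+1})\cdots(a_{i,j-1},h_{i,j-1})\ \&\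 (a_{i,j})_t\,(a_{i,j+1},h_{i,j+1})\cdots(a_{i,j'-1},h_{i,j'-1}).$$ (The scalar $[\cdot,\cdot]$ multiplies the whole link.) $\tilde B\subset\tilde A$ is the $\mathbb{C}[\mathrm{h}]$-submodule generated by all $X-X'-X''$ (case $i\ne i'$) and all $X-X'-\mathrm{h}X''$ (case $i=i'$). Set $A=\tilde A/\tilde B$.
   Formalization: The projection π̃ does not vanish on B̃: for X=(e,0)(e*,1) it sends X−X'−hX'' to −h e_s&e_t. Proved instead: A and SL[h] are free, and there is a C[h]-linear bijection A→SL[h] that agrees with π̃ on each heighted link up to terms with fewer arrows. *)

(* Defs.v *)
From HB Require Import structures.
From mathcomp Require Import all_boot all_order all_algebra.
From mathcomp Require Import finmap generic_quotient ring_quotient.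
From mathcomp Require Import boolp reals.
From mathcomp Require Import complex.
From mathcomp.multinomials Require Import monalg.

Set Implicit Arguments.
Unset Strict Implicit.
Unset Printing Implicit Defensive.

Import GRing.Theory.
Local Open Scope ring_scope.
Local Open Scope quotient_scope.

(** * Quotient of a module by the submodule generated by a set *)

Section ModuleQuotient.
Variables (K : pzRingType) (V : lmodType K) (S : V -> Prop).

Inductive mspan : V -> Prop :=
| mspan0 : mspan 0
| mspan_addZ (a : K) (g x : V) : S g -> mspan x -> mspan (a *: g + x).

Lemma mspanD x y : mspan x -> mspan y -> mspan (x + y).
Proof.
by elim=> [|a g u Sg _ IH] sy; rewrite ?add0r // -addrA; apply: mspan_addZ; auto.
Qed.

Lemma mspanZ a x : mspan x -> mspan (a *: x).
Proof.
elim=> [|b g u Sg _ IH]; first by rewrite scaler0; apply: mspan0.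
by rewrite scalerDr scalerA; apply: mspan_addZ.
Qed.

Definition mspanb : {pred V} := fun x => `[< mspan x >].

Fact mspanb_closed : zmod_closed mspanb.
Proof.
split=> [|x y /asboolP sx /asboolP sy]; first exact/asboolP/mspan0.
by apply/asboolP/mspanD => //; rewrite -scaleN1r; apply: mspanZ.
Qed.

HB.instance Definition _ := GRing.isZmodClosed.Build V mspanb mspanb_closed.

Definition modquot : Type := Quotient.quot mspanb.
HB.instance Definition _ := GRing.Zmodule.on modquot.

Definition modproj (x : V) : modquot := \pi_(Quotient.quot mspanb) x.

Lemma modprojP x y : reflect (mspan (x - y)) (modproj x == modproj y).
Proof. by rewrite /modproj -Quotient.idealrBE; apply: asboolP. Qed.

Lemma modproj_zmod_morphism : zmod_morphism modproj.
Proof. exact: (raddfB (\pi_(Quotient.quot mspanb))). Qed.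
HB.instance Definition _ :=
  GRing.isZmodMorphism.Build V modquot modproj modproj_zmod_morphism.

Lemma modproj_surj (u : modquot) : exists x, u = modproj x.
Proof. by exists (repr (u : Quotient.quot mspanb)); rewrite /modproj reprK. Qed.

Definition modscale (a : K) (u : modquot) : modquot :=
  modproj (a *: repr (u : Quotient.quot mspanb)).

Lemma modscaleE a x : modscale a (modproj x) = modproj (a *: x).
Proof.
apply/eqP/modprojP; rewrite -scalerBr; apply: mspanZ; apply/modprojP.
by rewrite /modproj reprK.
Qed.

Fact modscaleA a b u : modscale a (modscale b u) = modscale (a * b) u.
Proof. by case: (modproj_surj u) => x ->; rewrite !modscaleE scalerA. Qed.

Fact modscale1 : left_id 1 modscale.
Proof. by move=> u; case: (modproj_surj u) => x ->; rewrite modscaleE scale1r. Qed.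

Fact modscaleDr : right_distributive modscale +%R.
Proof.
move=> a u v; case: (modproj_surj u) (modproj_surj v) => [x ->] [y ->].
by rewrite -raddfD !modscaleE scalerDr raddfD.
Qed.

Fact modscaleDl u : {morph modscale^~ u : a b / a + b}.
Proof.
by move=> a b; case: (modproj_surj u) => x ->; rewrite !modscaleE scalerDl raddfD.
Qed.

HB.instance Definition _ := GRing.Zmodule_isLmodule.Build K modquot
  modscaleA modscale1 modscaleDr modscaleDl.

Lemma modproj_scalable : scalable modproj.
Proof. by move=> a x; rewrite -modscaleE. Qed.
HB.instance Definition _ :=
  GRing.isScalable.Build K V modquot *:%R modproj modproj_scalable.

End ModuleQuotient.

(* [{malg K[I]}] is the free [K]-module on the set [I]. *)
Definition free_module (K : nzRingType) (V : lmodType K) : Prop :=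
  exists (I : choiceType) (b : {linear {malg K[I]} -> V}), bijective b.

(** * Words up to cyclic rotation *)

Section CyclicWords.
Variable T : choiceType.

Definition rot_eq (s t : seq T) : bool := has (fun n => t == rot n s) (iota 0 (size s).+1).

Lemma rot_eqP s t : reflect (exists n, t = rot n s) (rot_eq s t).
Proof.
apply: (iffP hasP) => [[n _ /eqP->]|[n ->]]; first by exists n.
case: (leqP n (size s)) => [le_n|/ltnW lt_n].
  by exists n => //; rewrite mem_iota.
by exists 0%N; rewrite ?mem_iota // rot0 rot_oversize.
Qed.

Fact rot_eq_equiv : equiv_class_of rot_eq.
Proof.
split=> [s|s t|t s u].
- by apply/rot_eqP; exists 0%N; rewrite rot0.
- by apply/rot_eqP/rot_eqP => -[n ->];
    [exists (size (rot n s) - n)%N | exists (size (rot n t) - n)%N]; rewrite -[LHS](rotK n).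
- move=> /rot_eqP[m ->] /rot_eqP[n ->]; apply/rot_eqP.
  case: (leqP m (size s)) => [le_m|/ltnW lt_m]; last first.
    by exists n; rewrite [rot m s]rot_oversize.
  case: (leqP n (size s)) => [le_n|/ltnW lt_n]; last first.
    by exists m; rewrite rot_oversize // size_rot.
  by rewrite rot_add_mod //; eexists.
Qed.
Canonical rot_eq_equiv_rel := EquivRelPack rot_eq_equiv.

Definition cword := {eq_quot rot_eq}.
HB.instance Definition _ := Choice.on cword.
HB.instance Definition _ := EqQuotient.on cword.

Definition cyc (s : seq T) : cword := \pi_cword s.

Lemma cycP s t : reflect (exists n, t = rot n s) (cyc s == cyc t).
Proof. by rewrite /cyc piE; apply: rot_eqP. Qed.

End CyclicWords.

(** * Quivers *)

Record quiver := Quiver {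
  vertex : choiceType;
  edge : choiceType;
  esrc : edge -> vertex;
  etgt : edge -> vertex
}.

(* [inl e] is the edge [e] of the quiver, [inr e] is the reverse edge [e^*]. *)
Definition arrow (Q : quiver) : choiceType := (edge Q + edge Q)%type.

Section Arrows.
Variable Q : quiver.

Definition asrc (a : arrow Q) : vertex Q :=
  match a with inl e => esrc e | inr e => etgt e end.
Definition atgt (a : arrow Q) : vertex Q :=
  match a with inl e => etgt e | inr e => esrc e end.

Definition bracket (K : pzRingType) (a b : arrow Q) : K :=
  match a, b with
  | inl e, inr f => (e == f)%:R
  | inr e, inl f => - (e == f)%:R
  | _, _ => 0
  end.

Definition closed_path (w : seq (arrow Q)) : bool :=
  (w != [::]) && cycle (fun a b => atgt a == asrc b) w.

Lemma closed_path_rot n w : closed_path (rot n w) = closed_path w.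
Proof. by rewrite /closed_path rot_cycle -!size_eq0 size_rot. Qed.

(* [closed_path] is invariant under rotation, so the choice of [repr] is *)
(* immaterial. *)
Definition necklace : Type := {c : cword (arrow Q) | closed_path (repr c)}.
HB.instance Definition _ := Choice.on necklace.

(* The basis of [L]. *)
Definition Lbasis : choiceType := (necklace + vertex Q)%type.

Definition Lbasis_arrows (b : Lbasis) : nat :=
  match b with inl c => size (repr (val c)) | inr _ => 0%N end.

Definition narrows (m : {cmonom Lbasis}) : nat :=
  (\sum_(b <- finsupp m) m b * Lbasis_arrows b)%N.

End Arrows.

(** * Heighted links *)

Section Links.
Variable Q : quiver.

(* Words of arrows with heights, followed by isolated vertices. *)
Definition prelink : choiceType :=
  (seq (seq (arrow Q * nat)) * seq (vertex Q))%type.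

Definition heights (X : prelink) : seq nat := [seq p.2 | p <- flatten X.1].

Definition link_wf (X : prelink) : bool :=
  all (fun w => closed_path (unzip1 w)) X.1 && uniq (heights X).

Definition reheight (f : nat -> nat) (w : seq (arrow Q * nat)) :=
  [seq (p.1, f p.2) | p <- w].

Definition link_equiv (X Y : prelink) : Prop :=
  exists f : nat -> nat,
    [/\ {in heights X &, {mono f : m n / (m < n)%N}},
        perm_eq [seq cyc (reheight f w) | w <- X.1] [seq cyc w | w <- Y.1]
      & perm_eq X.2 Y.2].

Definition wlink : Type := {X : prelink | link_wf X}.
HB.instance Definition _ := Choice.on wlink.
Definition wlink_eq (X Y : wlink) : bool := `[< link_equiv (val X) (val Y) >].

Lemma cyc_reheight f u w :
  cyc u = cyc w -> cyc (reheight f u) = cyc (reheight f w).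
Proof.
by move=> /eqP/cycP[n ->]; apply/eqP/cycP; exists n; rewrite /reheight map_rot.
Qed.

Lemma map_cyc_reheight f (s t : seq (seq (arrow Q * nat))) :
  perm_eq [seq cyc w | w <- s] [seq cyc w | w <- t] ->
  perm_eq [seq cyc (reheight f w) | w <- s] [seq cyc (reheight f w) | w <- t].
Proof.
pose g (c : cword (arrow Q * nat)%type) := cyc (reheight f (repr c)).
have gE w : g (cyc w) = cyc (reheight f w).
  by apply: cyc_reheight; rewrite /cyc reprK.
move=> /(perm_map g); rewrite -!map_comp.
by rewrite (eq_map (g := fun w => cyc (reheight f w)) gE)
  (eq_map (g := fun w => cyc (reheight f w)) gE).
Qed.

Lemma perm_flatten_cyc (T : choiceType) (s t : seq (seq T)) :
  perm_eq [seq cyc w | w <- s] [seq cyc w | w <- t] ->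
  perm_eq (flatten s) (flatten t).
Proof.
have flatE (r : seq (seq T)) :
    perm_eq (flatten r) (flatten [seq repr c | c <- [seq cyc w | w <- r]]).
  elim: r => //= w r IH; apply: perm_cat => //.
  have /eqP/cycP[n ->] : cyc w = cyc (repr (cyc w)) by rewrite {2}/cyc reprK.
  by rewrite perm_sym; apply/permPl/perm_rot.
move=> st; rewrite (permPl (flatE s)) perm_sym (permPl (flatE t)) perm_sym.
exact/perm_flatten/perm_map.
Qed.

Lemma heights_reheight (f : nat -> nat) (s : seq (seq (arrow Q * nat))) vs :
  heights ([seq reheight f w | w <- s], vs) = map f (heights (s, vs)).
Proof. by rewrite /heights /= -map_comp -map_flatten -map_comp. Qed.

Lemma link_equiv_heights (f : nat -> nat) (X Y : prelink) :
  perm_eq [seq cyc (reheight f w) | w <- X.1] [seq cyc w | w <- Y.1] ->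
  perm_eq (map f (heights X)) (heights Y).
Proof.
move=> pXY; have := @perm_flatten_cyc _ [seq reheight f w | w <- X.1] Y.1.
rewrite -map_comp => /(_ pXY) /(perm_map snd).
by rewrite -/(heights ([seq reheight f w | w <- X.1], X.2)) heights_reheight; case: X {pXY}.
Qed.

Lemma reheight_id (f : nat -> nat) (s : seq (seq (arrow Q * nat))) vs :
  {in heights (s, vs), f =1 id} -> [seq reheight f w | w <- s] = s.
Proof.
move=> fid; rewrite -[RHS]map_id; apply/eq_in_map => w ws.
rewrite -[RHS]map_id; apply/eq_in_map => -[a h] wp /=; congr (_, _).
apply: fid; apply/mapP; exists (a, h) => //.
by apply/flattenP; exists w.
Qed.

Lemma link_equiv_refl X : link_equiv X X.
Proof.
exists id; split=> //; rewrite (eq_map (g := fun w => cyc w)) // => w.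
by rewrite /reheight (eq_map (g := id)) ?map_id // => -[].
Qed.

Lemma link_equiv_trans X Y Z :
  link_equiv X Y -> link_equiv Y Z -> link_equiv X Z.
Proof.
move=> [f [fmono pXY vXY]] [g [gmono pYZ vYZ]].
have hY h : h \in heights X -> f h \in heights Y.
  by move=> hX; rewrite -(perm_mem (link_equiv_heights pXY)) map_f.
exists (g \o f); split; last exact: perm_trans vXY vYZ.
  by move=> m n mX nX /=; rewrite gmono ?fmono ?hY.
apply: perm_trans pYZ.
have := @map_cyc_reheight g [seq reheight f w | w <- X.1] Y.1.
rewrite -!map_comp => /(_ pXY); congr perm_eq.
by apply: eq_map => w /=; rewrite /reheight -map_comp.
Qed.

Lemma link_equiv_sym X Y : link_equiv X Y -> link_equiv Y X.
Proof.
move=> [f [fmono pXY vXY]].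
have f_inj : {in heights X &, injective f}.
  move=> m n mX nX /= fmn; apply/eqP.
  by rewrite eqn_leq leqNgt [(n <= m)%N]leqNgt -(fmono n m) // -(fmono m n) // fmn ltnn.
pose g n := nth 0%N (heights X) (find (fun m => f m == n) (heights X)).
have fK : {in heights X, cancel f g}.
  move=> m mX; have fm : has (fun m' => f m' == f m) (heights X).
    by apply/hasP; exists m.
  by apply: f_inj; rewrite ?inE ?mem_nth -?has_find //; apply/eqP/(nth_find 0%N fm).
have hY := perm_mem (link_equiv_heights pXY).
exists g; split; last by rewrite perm_sym.
  move=> m n; rewrite -!hY => /mapP[m' m'X ->] /mapP[n' n'X ->].
  by rewrite !fK // fmono.
have := @map_cyc_reheight g [seq reheight f w | w <- X.1] Y.1.
rewrite -!map_comp => /(_ pXY); rewrite perm_sym; congr perm_eq.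
rewrite -[in RHS](@reheight_id (g \o f) X.1 X.2); last first.
  by move: fK; rewrite [in X in {in X, _}](surjective_pairing X).
rewrite -map_comp; apply: eq_map => w /=; rewrite /reheight -map_comp.
by [].
Qed.

Fact wlink_eq_equiv : equiv_class_of wlink_eq.
Proof.
split=> [X|X Y|Y X Z]; first exact/asboolP/link_equiv_refl.
  by apply/asboolP/asboolP; apply: link_equiv_sym.
by move=> /asboolP XY /asboolP YZ; apply/asboolP/(link_equiv_trans XY).
Qed.
Canonical wlink_eq_equiv_rel := EquivRelPack wlink_eq_equiv.

Definition hlink := {eq_quot wlink_eq}.
HB.instance Definition _ := Choice.on hlink.
HB.instance Definition _ := EqQuotient.on hlink.

(* All the [insub] succeed when [X] is well formed. *)
Definition components (X : prelink) : seq (Lbasis Q) :=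
  [seq inl c | c <- pmap insub [seq cyc (unzip1 w) | w <- X.1]]
    ++ [seq inr v | v <- X.2].

Definition forget_wlink (X : wlink) : {cmonom Lbasis Q} :=
  \big[mmul/mone]_(b <- components (val X)) ucm b.

Definition forget (X : hlink) : {cmonom Lbasis Q} := forget_wlink (repr X).

Lemma forget_pi (X : wlink) : forget (\pi_hlink X) = forget_wlink X.
Proof.
have /eqmodP/asboolP[f [_ pXY vXY]] : X = repr (\pi_hlink X) %[mod hlink].
  by rewrite reprK.
rewrite /forget /forget_wlink; apply/esym/perm_big.
apply: perm_cat; last exact: perm_map.
apply/perm_map/perm_pmap.
pose g (c : cword (arrow Q * nat)%type) := cyc (unzip1 (repr c)).
have gE w : g (cyc w) = cyc (unzip1 w).
  have /cycP[n En] : cyc w == cyc (repr (cyc w)) by rewrite {2}/cyc reprK.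
  by apply/eqP; rewrite eq_sym; apply/cycP; exists n; rewrite En /unzip1 map_rot.
move: pXY => /(perm_map g); rewrite -!map_comp; congr perm_eq; apply: eq_map => w /=.
  by rewrite gE /unzip1 -map_comp.
exact: gE.
Qed.

(* The component [w], or the vertex [v] when [w] is empty, added to [X]. *)
Definition add_component (v : vertex Q) (w : seq (arrow Q * nat)) (X : prelink) :
    prelink :=
  if w is [::] then (X.1, v :: X.2) else (w :: X.1, X.2).

Definition adjacent_heights (X : prelink) (h k : nat) : bool :=
  (h < k)%N && all (fun n => (n <= h)%N || (k <= n)%N) (heights X).

Variable R : realType.
Let Ch := {poly R[i]}.

(* [Atilde] is the free module on heighted links and [SLh] is [S(L)[h]], the *)
(* polynomials over [C[h]] in the elements of the basis of [L]; the formal *)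
(* parameter [h] is ['X]. *)
Definition Atilde : lmodType Ch := {malg Ch[hlink]}.
Definition SLh : lmodType Ch := {malg Ch[{cmonom Lbasis Q}]}.

Definition pi_tilde (x : Atilde) : SLh :=
  \sum_(X <- msupp x) x@_X *: (<< forget X >> : SLh).

Lemma pi_tildeEw (d : {fset hlink}) (x : Atilde) : (msupp x `<=` d)%fset ->
  pi_tilde x = \sum_(X <- d) x@_X *: (<< forget X >> : SLh).
Proof.
move=> le_xd; rewrite /pi_tilde (big_fset_incl _ le_xd) //= => X _ /mcoeff_outdom ->.
by rewrite scale0r.
Qed.

Fact pi_tilde_linear : linear pi_tilde.
Proof.
move=> a x y; pose d := (msupp x `|` msupp y `|` msupp (a *: x + y)%R)%fset.
rewrite !(@pi_tildeEw d) ?fsubsetUr //; last 2 first.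
- by rewrite /d -fsetUA fsetUCA fsubsetUl.
- by rewrite /d -fsetUA fsubsetUl.
rewrite scaler_sumr -big_split /=; apply: eq_bigr => X _.
by rewrite mcoeffD mcoeffZ scalerDl scalerA.
Qed.
HB.instance Definition _ := GRing.isLinear.Build Ch Atilde SLh *:%R pi_tilde
  pi_tilde_linear.

Lemma pi_tildeU X : pi_tilde << X >> = << forget X >>.
Proof.
by rewrite (@pi_tildeEw [fset X]%fset) ?msuppU_le // big_seq_fset1 mcoeffUU scale1r.
Qed.

(* Only meaningful on well formed prelinks. *)
Definition hl (X : prelink) : Atilde :=
  if insub X is Some Y then << \pi_hlink (Y : wlink) >> else 0.

(* Since words are cyclic and components unordered, the two arrows may be *)
(* assumed to come first in their words, and these words first in the link. *)
(* The link in the bracket term is well formed whenever the bracket is not 0. *)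
Inductive link_relation : Atilde -> Prop :=
| link_merge a h w b k u ws vs :
    let X := (((a, h) :: w) :: ((b, k) :: u) :: ws, vs) in
    let X' := (((a, k) :: w) :: ((b, h) :: u) :: ws, vs) in
    link_wf X -> adjacent_heights X h k ->
    link_relation (hl X - hl X'
      - bracket Ch a b *: hl (add_component (atgt a) (w ++ u) (ws, vs)))
| link_split a h w b k u ws vs :
    let X := (((a, h) :: w ++ (b, k) :: u) :: ws, vs) in
    let X' := (((a, k) :: w ++ (b, h) :: u) :: ws, vs) in
    link_wf X -> adjacent_heights X h k ->
    link_relation (hl X - hl X'
      - 'X *: (bracket Ch a b *:
          hl (add_component (atgt b) u (add_component (atgt a) w (ws, vs))))).

Definition Alinks : lmodType Ch := modquot link_relation.

Definition Alinks_proj : {linear Atilde -> Alinks} := @modproj Ch Atilde link_relation.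

(* [pi_tilde] does not vanish on the relations: it sends [X - X' - X''] to *)
(* [- pi_tilde X'']. But [X''] has two arrows fewer than [X], so [pi_tilde] is *)
(* compatible with the relations up to monomials with fewer arrows. *)
Definition narrows_lt (n : nat) (x : SLh) : Prop :=
  forall m, m \in msupp x -> (narrows m < n)%N.

End Links.

(* Main.v *)
Require Import Defs.
From HB Require Import structures.
From mathcomp Require Import all_boot all_order all_algebra fingroup perm.
From mathcomp Require Import finmap boolp generic_quotient.
From mathcomp Require Import reals complex.
From mathcomp.multinomials Require Import monalg.
From mathcomp Require Import zify.

(* Label the letters of a link by a finite type and record "next letter in the
   same cyclic word" as a permutation [f].  Contracting two letters [p], [q]
   multiplies [f] by the transposition [(p q)], which merges or splits words
   exactly as the relations do, and marks [p] and [q] as erased; contractions of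
   disjoint pairs therefore commute.  As in Wick's theorem, sum over all sets of
   disjoint contractions, where a pair [p] below [q] has weight [1] if [p] is an
   edge [e] and [q] is [e^*], [0] otherwise, and an extra factor [h] when a word
   is split.  Exchanging two adjacent heights changes this sum by the bracket
   times the sum for the contracted link, so it is compatible with the relations,
   and its leading term is the link with its heights forgotten.  Conversely the
   relations reorder heights modulo links with fewer arrows, so choosing one link
   over each monomial gives a spanning family of the quotient on which the sum is
   unitriangular. *)

Set Implicit Arguments.
Unset Strict Implicit.
Unset Printing Implicit Defensive.

Import GRing.Theory.
Local Open Scope ring_scope.
Local Open Scope quotient_scope.

(** * Contractions *)

(** Forgetting the heights sends a relation to minus its bracket term, so [pi_tilde] has to be
    corrected by terms with fewer arrows before it can descend; the sum over contractions is this
    correction. One definition must serve for merging, for splitting and for words that shrink to a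
    vertex. Therefore an erased letter is not removed at once: it stays in its cycle as a constant
    path, so that a cycle with no letter left still knows its vertex. Whether a given contraction
    splits a word depends on the contractions made before it, so the power of [h] seems to depend on
    their order. It does not: a transposition changes the number of cycles by exactly one, so the
    total exponent can be computed from the number of cycles at the end. The pairing is one-sided
    because exchanging two adjacent letters produces the difference of the weights in the two
    orders, and the bracket is exactly the antisymmetrisation of the pairing. The modules may have
    infinite rank, so the unitriangular map is inverted by induction on the number of arrows. *)

Section Wick.
Variables (K : comNzRingType) (V : lmodType K) (T : finType).
Variables (c : T -> T -> K) (t : K).

(* The permutation gives the next letter, the set collects the erased letters. *)
Definition wstate : Type := ({perm T} * {set T})%type.
Implicit Types (st : wstate) (p q r u : T) (s : seq T) (f : {perm T}).

(** Permutations compose from left to right, so the successor of [p] becomes the old successor of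
    [q] and conversely. This is the cut and reconnection at the two letters that produces the words
    of the bracket term. *)
Definition contract p q st : wstate :=
  ((tperm p q * st.1)%g, p |: (q |: st.2)).

(* The power of [t] counts the words that the contraction splits. *)
Definition weight st p q : K :=
  if [|| p \in st.2, q \in st.2 | p == q] then 0
  else c p q * t ^+ (p \in porbit st.1 q).

(** The first letter is either left alone or contracted with a later one. The partner [q] stays in
    the list: it is erased in the new state, so every later weight that involves it vanishes. *)
Fixpoint wick (F : wstate -> V) s st : V :=
  if s is p :: s' then
    wick F s' st + \sum_(q <- s') weight st p q *: wick F s' (contract p q st)
  else F st.

(** A transposition adds a cycle if its two letters share one, and otherwise removes one. Written
    without subtraction, this recovers the splitting indicator from cycle counts alone. *)
Lemma card_porbits_tperm f p q : p != q ->
  ((p \in porbit f q).*2 + #|porbits f| = #|porbits (tperm p q * f)%g| + 1)%N.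
Proof.
move=> npq; have := porbits_mul_tperm f p q; rewrite npq /=; move: npq.
by move/eqP=> npq'; case: (p \in _) => /=; rewrite -!mul2n; lia.
Qed.

Lemma tperm_disjointC p q r u : p != r -> p != u -> q != r -> q != u ->
  (tperm p q * tperm r u = tperm r u * tperm p q)%g.
Proof. by move=> pr pu qr qu; rewrite conjgC tpermJ !tpermD // eq_sym. Qed.

Lemma contractC st p q : contract p q st = contract q p st.
Proof. by rewrite /contract tpermC setUCA. Qed.

Lemma contract_comm st p q r u : p != r -> p != u -> q != r -> q != u ->
  contract p q (contract r u st) = contract r u (contract p q st).
Proof.
move=> pr pu qr qu; rewrite /contract /= !mulgA tperm_disjointC //; congr pair.
by apply/setP=> x; rewrite !inE; do !case: eqP => //=.
Qed.

(* Both sides vanish unless the four letters are distinct and not erased; then *)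
(* the two exponents of [t] are determined by the number of cycles at the end. *)
Lemma weight_comm st p q r u :
  weight st p q * weight (contract p q st) r u
  = weight st r u * weight (contract r u st) p q.
Proof.
rewrite /weight /= !inE.
have [_|pE] := boolP (p \in st.2); first by rewrite !orbT !mulr0 ?mul0r.
have [_|qE] := boolP (q \in st.2); first by rewrite !orbT !mulr0 ?mul0r.
have [_|rE] := boolP (r \in st.2); first by rewrite !orbT !mulr0 ?mul0r.
have [_|uE] := boolP (u \in st.2); first by rewrite !orbT !mulr0 ?mul0r.
rewrite !orbF /= [r == p]eq_sym [r == q]eq_sym [u == p]eq_sym [u == q]eq_sym.
have [_|npq] := eqVneq p q; first by rewrite !orbT mul0r mulr0.
have [_|nru] := eqVneq r u; first by rewrite !orbT mul0r mulr0.
have [_|npr] := eqVneq p r; first by rewrite mulr0 mulr0.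
have [_|nqr] := eqVneq q r; first by rewrite !orbT mulr0 mulr0.
have [_|npu] := eqVneq p u; first by rewrite !orbT mulr0 mulr0.
have [_|nqu] := eqVneq q u; first by rewrite !orbT mulr0 mulr0.
rewrite /= mulrACA [RHS]mulrACA -!exprD [c r u * _]mulrC; congr (_ * _ ^+ _).
have := card_porbits_tperm st.1 npq; have := card_porbits_tperm st.1 nru.
have := card_porbits_tperm (tperm p q * st.1)%g nru.
have := card_porbits_tperm (tperm r u * st.1)%g npq.
rewrite !mulgA tperm_disjointC //.
move: (nat_of_bool _) (nat_of_bool _) (nat_of_bool _) (nat_of_bool _).
move=> a1 a2 a3 a4; move: #|_| #|_| #|_| #|_| => n1 n2 n3 n4; rewrite -!mul2n.
clear; lia.
Qed.

Lemma weight_contract0 st p q r u :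
  [|| r == p, r == q, u == p | u == q] -> weight (contract p q st) r u = 0.
Proof.
rewrite /weight /= !inE => h.
case: ifP => // /norP[/norP[/negPf rp /norP[/negPf rq _]]].
by case/norP=> /norP[/negPf up /norP[/negPf uq _]] _; rewrite rp rq up uq in h.
Qed.

(** If the pairs overlap, both weights vanish, because a letter is contracted at most once; if they
    are disjoint, the contracted states coincide. *)
Lemma weight_contract_wick F s st p q r u :
  (weight st p q * weight (contract p q st) r u) *:
     wick F s (contract r u (contract p q st))
  = (weight st r u * weight (contract r u st) p q) *:
     wick F s (contract p q (contract r u st)).
Proof.
rewrite weight_comm.
have [h|] := boolP [|| p == r, p == u, q == r | q == u].
  by rewrite weight_contract0 // mulr0 !scale0r.
by rewrite !negb_or => /and4P[? ? ? ?]; rewrite (@contract_comm _ p q r u).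
Qed.

(** Apart from the contraction of [p] with [q], the two orders have the same terms, since pairs of
    contractions commute. This identity is the source of the compatibility with both kinds of
    relations. *)
Lemma wick_swap F s1 s2 p q st :
  wick F (s1 ++ p :: q :: s2) st - wick F (s1 ++ q :: p :: s2) st
  = (weight st p q - weight st q p) *: wick F (s1 ++ s2) (contract p q st).
Proof.
elim: s1 st => [|x s1 IH] st /=.
  (* [D] collects the terms in which [a] and [b] both have partners in [s2]. It is the only part
     whose symmetry in [a] and [b] is not visible. *)
  pose D a b := \sum_(r <- s2) \sum_(u <- s2)
    (weight st a r * weight (contract a r st) b u) *:
      wick F s2 (contract b u (contract a r st)).
  have E a b : wick F (a :: b :: s2) st = wick F s2 st
      + \sum_(r <- s2) weight st b r *: wick F s2 (contract b r st)
      + \sum_(r <- s2) weight st a r *: wick F s2 (contract a r st)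
      + weight st a b *: wick F s2 (contract a b st) + D a b.
    rewrite /= big_cons -!addrA; congr (_ + (_ + _)).
    rewrite [X in _ *: (_ + X)]big1_seq ?addr0; last first.
      by move=> r _; rewrite weight_contract0 ?eqxx ?orbT // scale0r.
    rewrite addrCA; congr (_ + _); rewrite -big_split /=; apply: eq_bigr => r _.
    rewrite scalerDr scaler_sumr; congr (_ + _); apply: eq_bigr => u _.
    by rewrite scalerA.
  have DC : D p q = D q p.
    rewrite /D exchange_big /=; apply: eq_bigr => r _; apply: eq_bigr => u _.
    exact: weight_contract_wick.
  rewrite -/(wick F (p :: q :: s2) st) -/(wick F (q :: p :: s2) st) !E DC.
  rewrite (contractC _ q p) (addrAC (wick F s2 st)) opprD addrACA subrr addr0.
  by rewrite opprD addrACA subrr add0r scalerBl.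
rewrite opprD addrACA IH scalerDr; congr (_ + _).
have pm : perm_eq (s1 ++ q :: p :: s2) (s1 ++ p :: q :: s2).
  by apply/seq.permP => a; rewrite !count_cat /=; lia.
rewrite (perm_big _ pm) /= -sumrB scaler_sumr.
under eq_bigr => r _ do rewrite -scalerBr IH scalerA mulrBr.
(* Once [x] is contracted with [p] or [q], these two can no longer be contracted with each other. *)
have z r : r \in [:: p; q] -> (weight st x r * weight (contract x r st) p q -
       weight st x r * weight (contract x r st) q p)
     *: wick F (s1 ++ s2) (contract p q (contract x r st)) = 0.
  by rewrite !inE => h; rewrite !weight_contract0 ?subrr ?mulr0 ?subrr ?scale0r //;
    case/orP: h => /eqP->; rewrite eqxx !orbT.
rewrite big_cat !big_cons z ?mem_head // z ?in_cons ?eqxx ?orbT //=.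
rewrite !add0r -big_cat /=.
apply: eq_bigr => r _.
(* The contraction of [x] with [r] is moved past that of [p] with [q], which gives the sum that
   unfolds [wick] at the state [contract p q st]. *)
rewrite scalerBl weight_contract_wick (contractC (contract x r st) p q).
rewrite (weight_contract_wick F _ st x r q p) (contractC st q p).
by rewrite -scalerBl -mulrBl scalerA.
Qed.

End Wick.

Lemma rot_filter (S : Type) (a : pred S) n (w : seq S) :
  exists k, filter a (rot n w) = rot k (filter a w).
Proof.
exists (size (filter a (take n w))).
by rewrite {1}/rot filter_cat -rot_size_cat -filter_cat cat_take_drop.
Qed.

(** * Reading off words *)

Section Pairing.
Variables (Q : quiver) (K : pzRingType).

Definition pairing (a b : arrow Q) : K :=
  if a is inl e then if b is inr e' then (e == e')%:R else 0 else 0.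

Lemma bracket_pairing (a b : arrow Q) : bracket K a b = pairing a b - pairing b a.
Proof. by case: a b => [e|e] [e'|e'] /=; rewrite ?subr0 // sub0r eq_sym. Qed.

Lemma pairing_neq0 (a b : arrow Q) :
  pairing a b != 0 -> @asrc Q a = @atgt Q b /\ @asrc Q b = @atgt Q a.
Proof.
case: a b => [e|e] [e'|e'] /=; rewrite ?eqxx //.
by case: (eqVneq e e') => [->|]; rewrite ?eqxx.
Qed.

Lemma bracket_neq0 (a b : arrow Q) :
  bracket K a b != 0 -> @asrc Q a = @atgt Q b /\ @asrc Q b = @atgt Q a.
Proof.
have [ab|] := eqVneq (pairing a b) 0; last by move/pairing_neq0.
have [ba|/pairing_neq0[-> ->] //] := eqVneq (pairing b a) 0.
by rewrite bracket_pairing ab ba subrr eqxx.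
Qed.

End Pairing.

(** The value [mone] on words that are not closed agrees with [components], which drops such words,
    and can only lower the number of arrows. *)
Definition necklace_monom (Q : quiver) (u : seq (arrow Q)) : {cmonom Lbasis Q} :=
  if insub (cyc u) is Some c then ucm (inl (c : necklace Q) : Lbasis Q) else mone.

Section Reading.
Variables (Q : quiver) (Ch : comNzRingType) (T : finType) (lab : T -> arrow Q).
Implicit Types (f : {perm T}) (E P : {set T}) (w : seq T) (ws : seq (seq T)).
Implicit Types (m : {cmonom Lbasis Q}) (x y p q r : T) (s : seq T).

Local Notation wstate := (wstate T).
Local Notation SL := {malg Ch[{cmonom Lbasis Q}]}.
Implicit Type st : wstate.

Definition surviving E w := [seq x <- w | x \notin E].

(* A word all of whose letters are erased is the vertex where it sits. *)
Definition read_word E w : {cmonom Lbasis Q} :=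
  match surviving E w, w with
  | [::], x :: _ => ucm (inr (asrc (lab x)) : Lbasis Q)
  | [::], [::] => mone
  | u, _ => necklace_monom (map lab u)
  end.

(** One factor per cycle, read from the root of the cycle. The set [P] allows letters to disappear
    while their type is kept. *)
Definition read P m (st : wstate) : SL :=
  << mmul m (\big[mmul/mone]_(x in P | froot st.1 x == x)
     read_word st.2 (orbit st.1 x)) >>.

(** An erased letter counts as the constant path at its source. The source is the right vertex:
    after the contraction of [p] with [q], the letter [p] is followed by the old successor of [q],
    which starts at the target of [q], and this is the source of [p]. *)
Definition letter_end E x := if x \in E then asrc (lab x) else atgt (lab x).

Definition coherent P (st : wstate) := forall x, x \in P ->
  st.1 x \in P /\ asrc (lab (st.1 x)) = letter_end st.2 x.

Definition spells P f ws :=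
  [/\ uniq (flatten ws), flatten ws =i P, [::] \notin ws
    & forall w, w \in ws -> fcycle f w].

Lemma letter_endU E p q x : asrc (lab p) = atgt (lab q) ->
  asrc (lab q) = atgt (lab p) -> p \notin E -> q \notin E ->
  letter_end E (tperm p q x) = letter_end (p |: (q |: E)) x.
Proof.
move=> pq qp pE qE; rewrite /letter_end !inE.
case: tpermP => [->|->|/eqP/negPf-> /eqP/negPf->] //=.
  by rewrite eqxx (negPf qE).
by rewrite eqxx orbT (negPf pE).
Qed.

Lemma coherent_contract P st p q :
  asrc (lab p) = atgt (lab q) -> asrc (lab q) = atgt (lab p) ->
  p \in P -> q \in P -> p \notin st.2 -> q \notin st.2 -> coherent P st ->
  coherent P (contract p q st).
Proof.
move=> pq qp pP qP pE qE co x xP; rewrite /= permM.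
have txP : tperm p q x \in P by case: tpermP.
by have [-> ->] := co _ txP; rewrite letter_endU.
Qed.

Section Spelling.
Variables (P : {set T}) (st : wstate).
Hypothesis co : coherent P st.

(** Along a cycle of erased letters every letter is a constant path, so coherence forces all their
    sources to agree. Hence the vertex does not depend on where the reading starts. *)
Lemma read_word_vertex w x : fcycle st.1 w -> {subset w <= P} -> x \in w ->
  surviving st.2 w = [::] -> read_word st.2 w = ucm (inr (asrc (lab x)) : Lbasis Q).
Proof.
move=> cw wP xw sw; rewrite /read_word sw; case: w => [|y w] // in cw wP xw sw *.
congr (ucm (inr _ : Lbasis Q)).
have /iter_findex <- : fconnect st.1 y x by rewrite (fconnect_cycle cw) ?mem_head.
elim: (findex _ _ _) => //= n IH.
have yn : iter n st.1 y \in y :: w.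
  by rewrite -(fconnect_cycle cw (mem_head y w)) fconnect_iter.
have [_ ->] := co (wP _ yn); rewrite /letter_end ifT //.
apply/negPn/negP => yE.
have : iter n st.1 y \in surviving st.2 (y :: w) by rewrite mem_filter yE.
by rewrite sw.
Qed.

Lemma read_word_rot n w : fcycle st.1 w -> {subset w <= P} ->
  read_word st.2 (rot n w) = read_word st.2 w.
Proof.
move=> cw wP; have [k Ek] := rot_filter (fun x => x \notin st.2) n w.
have cr : fcycle st.1 (rot n w) by rewrite rot_cycle.
case Ew: w => [|x w'] //; rewrite -Ew.
have xw : x \in w by rewrite Ew mem_head.
case Es: (surviving st.2 w) => [|y u].
  rewrite !(read_word_vertex (x := x)) ?mem_rot //.
    by move=> z; rewrite mem_rot; apply: wP.
  by rewrite /surviving Ek -/(surviving _ _) Es.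
rewrite /read_word Es /surviving Ek -/(surviving _ _) Es.
case Er: (rot k _) => [|z v]; first by move/(congr1 size): Er; rewrite size_rot.
rewrite -Er map_rot /necklace_monom.
suff -> : cyc (rot k (map lab (y :: u))) = cyc (map lab (y :: u)) by [].
by apply/esym/eqP/cycP; exists k.
Qed.

Lemma read_spells m ws : spells P st.1 ws ->
  read P m st = << mmul m (\big[mmul/mone]_(w <- ws) read_word st.2 w) >>.
Proof.
move=> [uw wP w0 cw]; rewrite /read; congr (<< mmul m _ >>).
rewrite (eq_bigl (fun x => (x \in flatten ws) && (froot st.1 x == x))); last first.
  by move=> x; rewrite wP.
have -> : \big[mmul/mone]_(x in flatten ws | froot st.1 x == x)
      read_word st.2 (orbit st.1 x)
    = \big[mmul/mone]_(x <- flatten ws | froot st.1 x == x)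
      read_word st.2 (orbit st.1 x).
  by rewrite big_mkcondr [RHS]big_mkcond big_uniq.
rewrite big_flatten; apply: eq_big_seq => w w_ws.
have cyw := cw w w_ws.
have sw : {subset w <= P} by move=> x xw; rewrite -wP; apply/flattenP; exists w.
have uqw : uniq w.
  move: uw; rewrite (perm_uniq (perm_flatten (perm_to_rem w_ws))) /= cat_uniq.
  by case/and3P.
case Ew: w => [|y w']; first by rewrite -Ew w_ws in w0.
rewrite -Ew; set z := froot st.1 y.
have yw : y \in w by rewrite Ew mem_head.
have zw : z \in w by rewrite -(fconnect_cycle cyw yw) connect_root.
(* A word is a single orbit, so exactly one of its letters is its own root. *)
rewrite big_seq_cond (eq_bigl (fun x => (x \in w) && (x == z))); last first.
  move=> x /=; case xw: (x \in w) => //=.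
  have /eqP-> : froot st.1 x == z.
    rewrite (root_connect (fconnect_sym (@perm_inj _ st.1))).
    by rewrite (fconnect_cycle cyw xw).
  by rewrite eq_sym.
rewrite -big_seq_cond -big_filter (filter_pred1_uniq uqw zw) big_seq1.
by have [i ->] := orbit_rot_cycle cyw uqw zw; rewrite read_word_rot.
Qed.

End Spelling.

(** Induction on the size of [P], splitting off the orbit of [x]. The chosen letter comes first in
    its word because that is where a letter can be removed. *)
Lemma spells_exists (f : {perm T}) P x : (forall y, y \in P -> f y \in P) ->
  x \in P -> exists w ws, spells P f ((x :: w) :: ws).
Proof.
have [n] := ubnP #|P|; elim: n => // n IH in P x * => leP fP xP.
have oP : {subset orbit f x <= P}.
  move=> y; rewrite -fconnect_orbit => /iter_findex <-.
  by elim: (findex _ _ _) => //= k; apply: fP.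
pose P' := P :\: [set y in orbit f x].
have P'P y : (y \in P') = (y \notin orbit f x) && (y \in P) by rewrite !inE.
have ox : orbit f x = x :: behead (orbit f x).
  by rewrite /orbit -orderSpred.
have [ws [uws wsP ws0 cws]] : exists ws, spells P' f ws.
  have [->|[y yP']] := set_0Vmem P'.
    by exists [::]; split=> // z; rewrite !inE.
  have ltP' : (#|P'| < n)%N.
    rewrite -ltnS; apply: leq_trans leP; rewrite ltnS; apply/proper_card/properP.
    split; first by apply/subsetP=> z; rewrite P'P => /andP[].
    by exists x => //; rewrite P'P in_orbit.
  have fP' z : z \in P' -> f z \in P'.
    rewrite !P'P => /andP[zx /fP->]; rewrite andbT.
    apply: contra zx; rewrite -!fconnect_orbit => h.
    by rewrite (same_fconnect1_r (@perm_inj _ f)).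
  by have [w [ws ?]] := IH P' y ltP' fP' yP'; exists ((y :: w) :: ws).
exists (behead (orbit f x)), ws; rewrite -ox; split.
- rewrite /= cat_uniq orbit_uniq uws andbT /=.
  by apply/hasPn=> y; rewrite wsP P'P => /andP[].
- move=> y; rewrite /= mem_cat wsP P'P; case: (boolP (y \in orbit f x)) => //= /oP->//.
- by rewrite inE ox /= (negPf ws0).
- move=> w; rewrite inE => /predU1P[->|/cws//].
  exact: cycle_orbit (@perm_inj _ f) x.
Qed.

Lemma spells_exists0 (f : {perm T}) P :
  (forall y, y \in P -> f y \in P) -> exists ws, spells P f ws.
Proof.
have [->|[x xP] fP] := set_0Vmem P; last first.
  by have [w [ws ?]] := spells_exists fP xP; exists ((x :: w) :: ws).
by exists [::]; split=> // z; rewrite !inE.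
Qed.

Lemma spells_cyc P (f : {perm T}) ws ws' :
  perm_eq (map (@cyc T) ws) (map (@cyc T) ws') -> spells P f ws -> spells P f ws'.
Proof.
move=> pw [uws wsP ws0 cws]; have pf := perm_flatten_cyc pw.
have ws'E w' : w' \in ws' -> exists2 w, w \in ws & exists n, w' = rot n w.
  move=> /(map_f (@cyc T)); rewrite -(perm_mem pw) => /mapP[w wws /esym/eqP/cycP ?].
  by exists w.
split.
- by rewrite -(perm_uniq pf).
- by move=> x; rewrite -(perm_mem pf).
- apply/negP=> /ws'E[w wws [n /esym/(congr1 size)]]; rewrite size_rot => /size0nil w0.
  by rewrite -w0 wws in ws0.
- by move=> w' /ws'E[w /cws cw [n ->]]; rewrite rot_cycle.
Qed.

Lemma spells_nextE P (f : {perm T}) ws w x : spells P f ws -> w \in ws -> x \in w ->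
  f x = next w x.
Proof. by move=> [_ _ _ cws] /cws cw xw; rewrite (nextE cw xw). Qed.

Lemma path_reroute (f g : T -> T) a b w z : g b = f a -> {in w, g =1 f} ->
  path (frel f) a (rcons w z) -> path (frel g) b (rcons w z).
Proof.
elim: w a b => [|y w IH] a b gb gf /=; first by rewrite gb.
rewrite gb => /andP[-> /=]; apply: IH; first by rewrite gf ?mem_head.
by move=> x xw; rewrite gf // inE xw orbT.
Qed.

(** The part common to merging and splitting: only the successors of [p] and [q] change, so the
    words [ws] that contain neither of them remain cycles. *)
Lemma spells_reroute P (f g : {perm T}) p w q u ws ws1 ws2 :
  perm_eq (flatten ws1) (p :: q :: w ++ u) ->
  perm_eq (flatten ws2) (flatten ws1) ->
  [::] \notin ws2 -> (forall x, x != p -> x != q -> g x = f x) ->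
  spells P f (ws1 ++ ws) ->
  ({in w, g =1 f} -> {in u, g =1 f} -> forall v, v \in ws2 -> fcycle g v) ->
  spells P g (ws2 ++ ws).
Proof.
move=> pf1 pf2 ws20 gf [uws wsP ws0 cws] cg.
have pf : perm_eq (flatten (ws2 ++ ws)) (flatten (ws1 ++ ws)).
  by rewrite !flatten_cat perm_cat2r.
have upq : uniq (p :: q :: (w ++ u) ++ flatten ws).
  rewrite -(perm_uniq (s1 := flatten (ws1 ++ ws))) //.
  by rewrite flatten_cat -!cat_cons perm_cat2r.
have gE x : x \in (w ++ u) ++ flatten ws -> g x = f x.
  move: upq => /= /and3P[]; rewrite inE negb_or => /andP[_ np] nq _ xw.
  by rewrite gf //; [apply: contraNneq np => <- | apply: contraNneq nq => <-].
split.
- by rewrite (perm_uniq pf).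
- by move=> x; rewrite (perm_mem pf).
- by move: ws0; rewrite !mem_cat !negb_or ws20 => /andP[].
- move=> v; rewrite mem_cat => /orP[|vws].
    by apply: cg => x xw; apply: gE; rewrite !mem_cat xw ?orbT.
  have cv : fcycle f v by apply: cws; rewrite mem_cat vws orbT.
  apply: (@sub_in_cycle _ (mem v) (frel f)) cv; last exact/allP.
  move=> x y xv _ /= /eqP <-; rewrite gE // mem_cat; apply/orP; right.
  by apply/flattenP; exists v.
Qed.

Lemma spells_merge P (f : {perm T}) p w q u ws :
  spells P f ((p :: w) :: (q :: u) :: ws) ->
  spells P (tperm p q * f)%g ((p :: u ++ q :: w) :: ws).
Proof.
move=> sp.
apply: (@spells_reroute P f _ p w q u ws [:: p :: w; q :: u] [:: _] _ _ _ _ sp) => //=.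
- by rewrite cats0; apply/seq.permP => a /=; rewrite !count_cat /=; lia.
- by rewrite !cats0; apply/seq.permP => a /=; rewrite !count_cat /=; lia.
- by move=> x xp xq; rewrite permM tpermD // eq_sym.
move=> gw gu v; rewrite inE => /eqP-> /=.
have [_ _ _ cws] := sp.
have cp := cws _ (mem_head _ _); have /= cq := cws (q :: u).
rewrite rcons_cat /= -cat_rcons cat_path last_rcons; apply/andP; split.
  by apply: (path_reroute _ gu) (cq _); rewrite ?permM ?tpermL // !inE eqxx orbT.
by apply: (path_reroute _ gw) cp; rewrite permM tpermR.
Qed.

Lemma spells_split P (f : {perm T}) p w q u ws :
  spells P f ((p :: w ++ q :: u) :: ws) ->
  spells P (tperm p q * f)%g ((p :: u) :: (q :: w) :: ws).
Proof.
move=> sp.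
apply: (@spells_reroute P f _ p w q u ws [:: _] [:: p :: u; q :: w] _ _ _ _ sp) => //=.
- by rewrite cats0; apply/seq.permP => a /=; rewrite !count_cat /=; lia.
- by rewrite !cats0; apply/seq.permP => a /=; rewrite !count_cat /=; lia.
- by move=> x xp xq; rewrite permM tpermD // eq_sym.
move=> gw gu v; have [_ _ _ cws] := sp.
have := cws _ (mem_head _ _).
rewrite /= rcons_cat /= -cat_rcons cat_path last_rcons => /andP[cw cu].
rewrite !inE => /orP[]/eqP-> /=.
  by apply: (path_reroute _ gu) cu; rewrite permM tpermL.
by apply: (path_reroute _ gw) cw; rewrite permM tpermR.
Qed.

End Reading.

(** * Removing erased letters *)

Section Erase.
Variables (T : finType).
Implicit Types (f : {perm T}) (x y p q r : T).

(** The cycle is closed up over [r]: its predecessor is sent to its successor, and [r] becomes a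
    fixed point. *)
Definition erase r f : {perm T} := (f * tperm r (f r))%g.

Lemma erase_tperm r p q f : p != r -> q != r ->
  erase r (tperm p q * f)%g = (tperm p q * erase r f)%g.
Proof. by move=> pr qr; rewrite /erase mulgA permM tpermD. Qed.

Lemma eraseE r f x : x != r -> f x != r -> erase r f x = f x.
Proof.
move=> xr fxr; rewrite /erase permM tpermD //; first by rewrite eq_sym.
by rewrite (inj_eq perm_inj) eq_sym.
Qed.

Lemma erase_pre r f x : f x = r -> erase r f x = f r.
Proof. by move=> fx; rewrite /erase permM fx tpermL. Qed.

Lemma card_porbits_erase r f :
  (#|porbits (erase r f)| = #|porbits f| + (f r != r))%N.
Proof.
have [fr|nfr] := eqVneq (f r) r.
  by rewrite /erase fr tperm1 mulg1 addn0.
have npr : (f^-1)%g r != r by apply: contra nfr => /eqP h; rewrite -{1}h permKV.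
(* Bypassing [r] is also a transposition of [r] with its predecessor. Both lie in one cycle, so the
   cycle count grows by one. *)
have -> : erase r f = (tperm ((f^-1)%g r) r * f)%g.
  by rewrite /erase conjgCV tpermJ permK.
have := card_porbits_tperm f npr.
have -> : (f^-1)%g r \in porbit f r.
  by rewrite -[X in porbit f X](permKV f) porbit_sym -{1}(expg1 f) mem_porbit.
by rewrite -!mul2n; move: #|_| #|_|; clear; lia.
Qed.

(** Erasing [r] commutes with the transposition of [p] and [q] and shifts the cycle counts before
    and after it equally, so the splitting indicator is unchanged. *)
Lemma porbit_erase r f p q : p != r -> q != r ->
  (p \in porbit (erase r f) q) = (p \in porbit f q).
Proof.
move=> pr qr; have [->|npq] := eqVneq p q; first by rewrite !porbit_id.
have := card_porbits_tperm f npq; have := card_porbits_tperm (erase r f) npq.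
rewrite -erase_tperm // !card_porbits_erase permM tpermD //.
move: (_ \in _) (_ \in _) => [] [] //=; move: #|_| #|_| (nat_of_bool _); clear; lia.
Qed.

End Erase.

(** * Symbols and their behaviour under removal and renaming of letters *)

Section Symbol.
Variables (Q : quiver) (Ch : comNzRingType) (t : Ch).

(* [P] is the set of letters of the link, [m] the product of its isolated *)
(* vertices, and [s] lists the letters by increasing height. *)
Definition symbol (T : finType) (lab : T -> arrow Q) (P : {set T}) m s st :=
  wick (fun p q => pairing Ch (lab p) (lab q)) t (read Ch lab P m) s st.

Section Letters.
Variables (T : finType) (lab : T -> arrow Q).
Implicit Types (f : {perm T}) (E P : {set T}) (w : seq T) (ws : seq (seq T)).
Implicit Types (m : {cmonom Lbasis Q}) (x y p q r : T) (s : seq T).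
Implicit Types (st : wstate T).

Local Notation pweight := (weight (fun p q => pairing Ch (lab p) (lab q)) t).

Lemma coherent_contract_pairing P st p q :
  p \in P -> q \in P -> coherent lab P st -> pweight st p q != 0 ->
  coherent lab P (contract p q st).
Proof.
move=> pP qP co; rewrite /weight; case: ifP => [|/norP[pE /norP[qE _]]].
  by rewrite eqxx.
case: (eqVneq (pairing Ch (lab p) (lab q)) 0) => [->|]; first by rewrite mul0r eqxx.
by move=> /pairing_neq0[pq qp] _; apply: coherent_contract.
Qed.

(** If [r] is alone in its cycle, removing it would lose the vertex that the cycle stands for; this
    vertex is moved to the isolated ones. *)
Definition free_vertex r f m : {cmonom Lbasis Q} :=
  if f r == r then mmul m (ucm (inr (asrc (lab r)) : Lbasis Q)) else m.

Lemma coherent_erase P st r : r \in st.2 -> r \in P -> coherent lab P st ->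
  coherent lab (P :\ r) (erase r st.1, st.2 :\ r).
Proof.
move=> rE rP co x; rewrite !inE /= => /andP[xr xP].
have [fxP fx] := co _ xP; have [frP fr] := co _ rP.
have -> : letter_end lab (st.2 :\ r) x = letter_end lab st.2 x.
  by rewrite /letter_end !inE xr.
have [fxr|nfxr] := eqVneq (st.1 x) r; last by rewrite eraseE // nfxr fxP.
rewrite erase_pre // frP andbT fr -fx fxr /letter_end rE; split=> //.
by apply: contra xr => /eqP frr; rewrite -(inj_eq (@perm_inj _ st.1)) frr fxr.
Qed.

(** The counterpart of [add_component] for words of letters: an empty word is recorded as an
    isolated vertex elsewhere. *)
Definition cons_word w ws := if w is [::] then ws else w :: ws.

Lemma spells_fixed P f r w ws : spells P f ((r :: w) :: ws) ->
  (f r == r) = (w == [::]).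
Proof.
move=> sp; have [uws _ _ _] := sp.
rewrite (spells_nextE sp (mem_head _ _) (mem_head _ _)) /=.
case: w => [|y w] in sp uws *; rewrite /= ?eqxx //.
by move: uws; rewrite /= inE; case: eqVneq => // ->; rewrite eqxx.
Qed.

Lemma spells_erase P f r w ws : spells P f ((r :: w) :: ws) ->
  spells (P :\ r) (erase r f) (cons_word w ws).
Proof.
move=> [uws wsP ws0 cws].
have /= /andP[rw uws'] := uws.
have cyc_erase v : fcycle f v -> r \notin v -> fcycle (erase r f) v.
  move=> cv rv; apply: (@sub_in_cycle _ (mem v) (frel f)) => //.
    move=> a b av bv /= /eqP <-; rewrite eraseE //; first by apply: contraNneq rv => <-.
    by move: (cv) => /nextE/(_ a av) <-; apply: contraNneq rv => <-; rewrite mem_next.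
have cws' v : v \in ws -> fcycle (erase r f) v.
  move=> vws; apply: cyc_erase; first by apply: cws; rewrite inE vws orbT.
  apply: contra rw => rv; rewrite mem_cat; apply/orP; right.
  by apply/flattenP; exists v.
have ws0' : [::] \notin ws by apply: contra ws0; rewrite inE => ->; rewrite orbT.
have wsP' x : x \in w ++ flatten ws = (x \in P :\ r).
  rewrite !inE -wsP /= inE; case: eqVneq => [->|] //=; exact: negPf.
have := cws _ (mem_head _ _); case: w => [|y w] in uws wsP ws0 cws rw uws' wsP' *.
  by move=> _; split.
move=> /= /andP[/eqP fr]; rewrite rcons_path => /andP[py /eqP lr].
have ryw : r \notin y :: w by apply: contra rw; rewrite mem_cat => ->.
have yr : y != r by apply: contraNneq ryw => ->; rewrite mem_head.
split=> //.
move=> v; rewrite inE => /predU1P[->|/cws'//].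
rewrite /= rcons_path /= erase_pre // fr eqxx andbT.
apply: (@sub_in_path _ (mem (y :: w)) (frel f)) py => //.
  move=> a b ay by_ /= /eqP fab; rewrite eraseE ?fab //.
    by apply: contraTneq ay => ->.
  by apply: contraTneq by_ => ->.
exact/allP.
Qed.

Lemma read_erase P m st r : r \in st.2 -> r \in P -> coherent lab P st ->
  read Ch lab P m st
  = read Ch lab (P :\ r) (free_vertex r st.1 m) (erase r st.1, st.2 :\ r).
Proof.
move=> rE rP co; have fP y : y \in P -> st.1 y \in P by case/co.
have co' := coherent_erase rE rP co.
have [w [ws sp]] := spells_exists fP rP.
rewrite (read_spells Ch co _ sp) (read_spells Ch co' _ (spells_erase sp)).
rewrite /free_vertex (spells_fixed sp) /=; have [/= /andP[rw _] _ _ _] := sp.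
have survE v : r \notin v -> surviving (st.2 :\ r) v = surviving st.2 v.
  move=> rv; apply: eq_in_filter => x xv; rewrite !inE.
  by rewrite (_ : x != r) //; apply: contraNneq rv => <-.
have readE v : r \notin v -> read_word lab (st.2 :\ r) v = read_word lab st.2 v.
  by move=> rv; rewrite /read_word survE.
have {}readE : \big[mmul/mone]_(v <- ws) read_word lab (st.2 :\ r) v
    = \big[mmul/mone]_(v <- ws) read_word lab st.2 v.
  apply: eq_big_seq => v vws; apply: readE; apply: contra rw => rv.
  by rewrite mem_cat; apply/orP; right; apply/flattenP; exists v.
have readr v : read_word lab st.2 (r :: v)
    = if surviving st.2 v is [::] then ucm (inr (asrc (lab r)) : Lbasis Q)
      else necklace_monom (map lab (surviving st.2 v)).
  by rewrite /read_word /surviving /= rE; case: [seq _ <- _ | _].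
rewrite big_cons readr; case: w => [|y w] in sp rw *; first by rewrite /= mulmA readE.
have ryw : r \notin y :: w by apply: contra rw; rewrite mem_cat => ->.
rewrite big_cons readE; suff -> : read_word lab (st.2 :\ r) (y :: w)
    = if surviving st.2 (y :: w) is [::] then ucm (inr (asrc (lab r)) : Lbasis Q)
      else necklace_monom (map lab (surviving st.2 (y :: w))) by [].
rewrite /read_word survE //; case: (surviving _ _) => //.
(* In a fully erased word the vertex is now read at [y], the successor of the erased [r]; by
   coherence both have the same source. *)
have := spells_nextE sp (mem_head _ _) (mem_head _ _); rewrite /= eqxx => fr.
by have [_] := co _ rP; rewrite fr /letter_end rE => ->.
Qed.

(* The letters consumed by a contraction can be removed, which identifies the *)
(* contracted link with the bracket term of a relation. *)
Lemma symbol_erase P m s st r : r \in st.2 -> r \in P -> coherent lab P st ->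
  {subset s <= P :\ r} ->
  symbol lab P m s st
  = symbol lab (P :\ r) (free_vertex r st.1 m) s (erase r st.1, st.2 :\ r).
Proof.
rewrite /symbol => rE rP; elim: s st rE => [|p s IH] st rE co sP /=.
  exact: read_erase.
have sP' : {subset s <= P :\ r} by move=> x xs; apply: sP; rewrite inE xs orbT.
refine (f_equal2 +%R (IH st rE co sP') _).
apply: eq_big_seq => q qs.
have /setD1P[pr pP] := sP _ (mem_head _ _); have /setD1P[qr qP] := sP' _ qs.
have -> : pweight (erase r st.1, st.2 :\ r) p q = pweight st p q.
  by rewrite /weight /= !inE pr qr porbit_erase.
have [->|nw] := eqVneq (pweight st p q) 0; first by rewrite !scale0r.
have rE' : r \in (contract p q st).2 by rewrite !inE rE !orbT.
have co' : coherent lab P (contract p q st) by apply: coherent_contract_pairing.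
refine (etrans (f_equal (fun z => pweight st p q *: z) (IH _ rE' co' sP')) _).
have -> : free_vertex r (contract p q st).1 m = free_vertex r st.1 m.
  by rewrite /free_vertex permM tpermD.
suff -> : (erase r (contract p q st).1, (contract p q st).2 :\ r)
   = contract p q (erase r st.1, st.2 :\ r) by [].
rewrite /contract /= erase_tperm //; congr (_, _); apply/setP=> x; rewrite !inE.
by case: (eqVneq x r) => [->|] //=; rewrite ![r == _]eq_sym (negPf pr) (negPf qr).
Qed.

End Letters.

Section Transport.
Variables (T T' : finType) (lab : T -> arrow Q) (i : T' -> T).
Hypothesis inj_i : injective i.

Lemma read_transport (P' : {set T'}) m (st : wstate T) (st' : wstate T') :
  coherent lab (i @: P') st -> (forall x, st.1 (i x) = i (st'.1 x)) ->
  (forall x, (i x \in st.2) = (x \in st'.2)) ->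
  read Ch lab (i @: P') m st = read Ch (lab \o i) P' m st'.
Proof.
move=> co fi Ei.
have co' : coherent (lab \o i) P' st'.
  move=> x xP; have [] := co (i x) (imset_f _ xP).
  by rewrite fi mem_imset // /letter_end Ei.
have [ws sp] : exists ws, spells P' st'.1 ws.
  by apply: spells_exists0 => z /co'[].
have sp' : spells (i @: P') st.1 [seq [seq i x | x <- w] | w <- ws].
  case: sp => uws wsP ws0 cws; split.
  - by rewrite -map_flatten map_inj_uniq.
  - move=> x; rewrite -map_flatten; apply/mapP/imsetP => -[y];
      by exists y; rewrite // ?wsP // -wsP.
  - apply/mapP => -[w wws /esym/eqP]; rewrite -size_eq0 size_map size_eq0 => /eqP w0.
    by rewrite -w0 wws in ws0.
  - move=> v /mapP[w /cws cw ->]; rewrite cycle_map.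
    by rewrite (eq_cycle (e' := frel st'.1)) // => x y /=; rewrite fi inj_eq.
rewrite (read_spells Ch co' _ sp) (read_spells Ch co _ sp') big_map.
congr (<< mmul m _ >>); apply: eq_bigr => w _; rewrite /read_word.
have -> : surviving st.2 (map i w) = map i (surviving st'.2 w).
  by rewrite /surviving filter_map; congr map; apply: eq_filter => x /=; rewrite Ei.
by case: (surviving _ _) => [|x u]; [case: w | rewrite /= -map_comp].
Qed.

Lemma porbit_transport (f : {perm T}) (f' : {perm T'}) x y :
  (forall x, f (i x) = i (f' x)) -> (i x \in porbit f (i y)) = (x \in porbit f' y).
Proof.
move=> fi; have it n z : (f ^+ n)%g (i z) = i ((f' ^+ n)%g z).
  by rewrite !permX; elim: n => //= n ->.
apply/porbitP/porbitP => -[n]; rewrite ?it => E; exists n; rewrite ?it.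
  exact: inj_i.
by rewrite E.
Qed.

(** Only the labels, the successor relation and the order of the letters matter. This allows a link
    to be treated with whichever letter type is convenient. *)
Lemma symbol_transport (P' : {set T'}) m s (st : wstate T) (st' : wstate T') :
  coherent lab (i @: P') st -> (forall x, st.1 (i x) = i (st'.1 x)) ->
  (forall x, (i x \in st.2) = (x \in st'.2)) -> {subset s <= P'} ->
  symbol lab (i @: P') m (map i s) st = symbol (lab \o i) P' m s st'.
Proof.
rewrite /symbol; elim: s st st' => [|p s IH] st st' co fi Ei sP /=.
  exact: read_transport.
have sP' : {subset s <= P'} by move=> x xs; apply: sP; rewrite inE xs orbT.
rewrite big_map; refine (f_equal2 +%R (IH st st' co fi Ei sP') _).
apply: eq_big_seq => q qs.
have wE : weight (fun p q => pairing Ch (lab p) (lab q)) t st (i p) (i q)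
  = weight (fun p q => pairing Ch ((lab \o i) p) ((lab \o i) q)) t st' p q.
  by rewrite /weight !Ei (inj_eq inj_i) (porbit_transport _ _ fi).
rewrite -wE; set W := weight _ _ _ _ _.
have [->|nw] := eqVneq W 0; first by rewrite !scale0r.
have co' : coherent lab (i @: P') (contract (i p) (i q) st).
  apply: coherent_contract_pairing co nw; apply/imset_f; first exact/sP/mem_head.
  exact: sP'.
refine (f_equal (fun z => W *: z) (IH _ (contract p q st') co' _ _ sP')).
- by move=> x; rewrite /= !permM -(inj_tperm _ _ _ inj_i) fi.
- by move=> x; rewrite !inE Ei !(inj_eq inj_i).
Qed.

End Transport.
End Symbol.

(** * Leading terms *)

Section Narrows.
Variables (Q : quiver).
Implicit Types (m : {cmonom Lbasis Q}).

Lemma narrowsEw m (d : {fset Lbasis Q}) : (finsupp m `<=` d)%fset ->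
  narrows m = (\sum_(b <- d) m b * Lbasis_arrows b)%N.
Proof.
move=> le_md; rewrite /narrows (big_fset_incl _ le_md) //= => b _.
by rewrite -cmE_eq0 => /eqP->.
Qed.

Lemma narrowsM m1 m2 : narrows (mmul m1 m2) = (narrows m1 + narrows m2)%N.
Proof.
rewrite !(@narrowsEw _ (finsupp m1 `|` finsupp m2)%fset) ?fsubsetUl ?fsubsetUr //.
  by rewrite -big_split; apply: eq_bigr => b _; rewrite cmM mulnDl.
by rewrite mdomD.
Qed.

Lemma narrows1 : narrows (mone : {cmonom Lbasis Q}) = 0%N.
Proof. by rewrite /narrows mdom1 big_seq_fset0. Qed.

Lemma narrowsU b : narrows (ucm b : {cmonom Lbasis Q}) = Lbasis_arrows b.
Proof. by rewrite /narrows mdomU big_seq_fset1 cmUU mul1n. Qed.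

Lemma narrows_prod (I : Type) (r : seq I) (F : I -> {cmonom Lbasis Q}) :
  narrows (\big[mmul/mone]_(i <- r) F i) = (\sum_(i <- r) narrows (F i))%N.
Proof. exact: (big_morph _ narrowsM narrows1). Qed.

Lemma size_repr_cyc (T : choiceType) (u : seq T) : size (repr (cyc u)) = size u.
Proof.
have /cycP[n ->] : cyc u == cyc (repr (cyc u)) by rewrite {2}/cyc reprK.
by rewrite size_rot.
Qed.

Lemma closed_path_repr (u : seq (arrow Q)) : closed_path (repr (cyc u)) = closed_path u.
Proof.
have /cycP[n ->] : cyc u == cyc (repr (cyc u)) by rewrite {2}/cyc reprK.
by rewrite closed_path_rot.
Qed.

Lemma narrows_necklace (u : seq (arrow Q)) :
  narrows (necklace_monom u) = (if closed_path u then size u else 0)%N.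
Proof.
rewrite /necklace_monom; case: insubP => [c|] /=; rewrite closed_path_repr.
  by move=> -> cE; rewrite narrowsU /= cE size_repr_cyc.
by move=> /negPf->; rewrite narrows1.
Qed.

Lemma narrows_read_word (T : finType) (lab : T -> arrow Q) E w :
  (narrows (read_word lab E w) <= size (surviving E w))%N.
Proof.
rewrite /read_word; case: (surviving _ _) => [|x u].
  by case: w => [|y w]; rewrite ?narrows1 ?narrowsU.
by rewrite narrows_necklace; case: ifP => //; rewrite size_map.
Qed.

End Narrows.

Section NarrowsLt.
Variables (R : realType) (Q : quiver).
Local Notation Ch := {poly R[i]}.
Implicit Types (x y : SLh Q R) (n : nat).

Lemma narrows_lt0 n : narrows_lt n (0 : SLh Q R).
Proof. by move=> m; rewrite msupp0. Qed.

Lemma narrows_ltD n x y : narrows_lt n x -> narrows_lt n y -> narrows_lt n (x + y).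
Proof.
by move=> hx hy m /(fsubsetP (msuppD_le _ _)); rewrite inE => /orP[/hx|/hy].
Qed.

Lemma narrows_ltZ n (a : Ch) x : narrows_lt n x -> narrows_lt n (a *: x).
Proof. by move=> hx m /(fsubsetP (msuppZ_le _ _)) /hx. Qed.

Lemma narrows_ltU n m : (narrows m < n)%N -> narrows_lt n (<< m >> : SLh Q R).
Proof. by move=> hm k /(fsubsetP msuppU_le); rewrite inE => /eqP->. Qed.

Lemma narrows_lt_sum n (I : eqType) (r : seq I) (F : I -> SLh Q R) :
  (forall i, i \in r -> narrows_lt n (F i)) -> narrows_lt n (\sum_(i <- r) F i).
Proof.
move=> hF; rewrite big_seq; elim/big_rec: _ => [|i y ir hy]; first exact: narrows_lt0.
exact: narrows_ltD (hF _ ir) hy.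
Qed.

Lemma narrows_lt_le n n' x : (n <= n')%N -> narrows_lt n x -> narrows_lt n' x.
Proof. by move=> le_n hx m /hx /leq_trans; apply. Qed.

Variables (t : Ch) (T : finType) (lab : T -> arrow Q).
Implicit Types (P : {set T}) (st : wstate T).

Lemma narrows_read P m st : coherent lab P st ->
  narrows_lt (narrows m + #|P :\: st.2|).+1 (read Ch lab P m st : SLh Q R).
Proof.
move=> co; have [ws sp] : exists ws, spells P st.1 ws.
  by apply: spells_exists0 => x /co[].
rewrite (read_spells Ch co m sp); apply: narrows_ltU.
rewrite ltnS narrowsM leq_add2l narrows_prod.
apply: (@leq_trans (\sum_(w <- ws) size (surviving st.2 w))%N).
  by apply: leq_sum => w _; apply: narrows_read_word.
have [uws wsP _ _] := sp.
suff -> : (\sum_(w <- ws) size (surviving st.2 w)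
    = size (surviving st.2 (flatten ws)))%N.
  rewrite cardE; apply: uniq_leq_size; first by rewrite filter_uniq.
  by move=> x; rewrite mem_filter mem_enum inE wsP.
rewrite /surviving; elim: (ws) => [|w ws' IH]; first by rewrite big_nil.
by rewrite big_cons IH /= filter_cat size_cat.
Qed.

(** A contraction of nonzero weight erases a letter of [P] not erased before, and a reading has at
    most one arrow per surviving letter. So all terms except the one without contractions fall below
    the bound. *)
Lemma symbol_top P m s st : coherent lab P st -> {subset s <= P} ->
  narrows_lt (narrows m + #|P :\: st.2|)
    (symbol t lab P m s st - read Ch lab P m st : SLh Q R).
Proof.
rewrite /symbol; elim: s st => [|p s IH] st co sP /=.
  by rewrite subrr; apply: narrows_lt0.
have sP' : {subset s <= P} by move=> x xs; apply: sP; rewrite inE xs orbT.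
rewrite addrAC; apply: narrows_ltD; first exact: IH.
apply: narrows_lt_sum => q qs; set W := weight _ _ _ _ _.
have [->|nw] := eqVneq W 0; first by rewrite scale0r; apply: narrows_lt0.
apply: narrows_ltZ.
have pP : p \in P by apply/sP/mem_head.
have co' := coherent_contract_pairing pP (sP' _ qs) co nw.
have pE : p \notin st.2.
  by apply: contraNN nw => pE; rewrite /W /weight pE.
have ltE : (narrows m + #|P :\: (contract p q st).2| < narrows m + #|P :\: st.2|)%N.
  rewrite ltn_add2l; apply/proper_card/properP; split.
    by apply/setDS/subsetP => x xE; rewrite !inE xE !orbT.
  by exists p; rewrite !inE ?pE ?pP // eqxx.
(* [h1] bounds the contracted symbol up to its own leading term, and [h2] bounds that leading
   term. *)
have h1 := narrows_lt_le (ltnW ltE) (IH _ co' sP').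
have h2 := narrows_lt_le ltE (narrows_read (m := m) co').
by have := narrows_ltD h1 h2; rewrite subrK.
Qed.

End NarrowsLt.

(** * The symbol of a heighted link *)

Section NextPerm.
Variable T : finType.
Implicit Types (w : seq T) (ws : seq (seq T)) (x : T).

(* The identity when [w] has repeated letters. *)
Definition cycle_perm w : {perm T} :=
  @insubd {ffun T -> T} (fun g => injectiveb g) {perm T} (perm_one T)
    [ffun x => next w x].

Lemma cycle_permE w x : uniq w -> cycle_perm w x = next w x.
Proof.
move=> uw; have inj : injectiveb [ffun y => next w y].
  by apply/injectiveP => y z; rewrite !ffunE => /(can_inj (prev_next uw)).
by rewrite -pvalE /cycle_perm val_insubd inj ffunE.
Qed.

Definition next_perm ws : {perm T} := (\prod_(w <- ws) cycle_perm w)%g.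

Lemma next_permE ws : uniq (flatten ws) ->
  (forall w x, w \in ws -> x \in w -> next_perm ws x = next w x)
  /\ (forall x, x \notin flatten ws -> next_perm ws x = x).
Proof.
rewrite /next_perm; elim: ws => [|w ws IH] /=.
  by split=> // x _; rewrite big_nil perm1.
rewrite cat_uniq => /and3P[uw dw /IH[IH1 IH2]].
have notw x : x \notin w -> cycle_perm w x = x.
  by move=> xw; rewrite cycle_permE // next_nth (negPf xw).
split=> [v x|x]; last first.
  by rewrite mem_cat negb_or => /andP[xw xws]; rewrite big_cons permM notw ?IH2.
rewrite inE big_cons permM => /predU1P[->|vws] xv.
  rewrite cycle_permE // IH2 //; apply: contra dw => h; apply/hasP.
  by exists (next w x) => //; rewrite mem_next.
rewrite notw; first exact: IH1.
apply: contra dw => xw; apply/hasP; exists x => //; by apply/flattenP; exists v.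
Qed.

Lemma uniq_word ws w : uniq (flatten ws) -> w \in ws -> uniq w.
Proof.
move=> uws wws; move: uws.
by rewrite (perm_uniq (perm_flatten (perm_to_rem wws))) /= cat_uniq => /and3P[].
Qed.

Lemma spells_next_perm (P : {set T}) ws : uniq (flatten ws) -> flatten ws =i P ->
  [::] \notin ws -> spells P (next_perm ws) ws.
Proof.
move=> uws wsP ws0; split=> // w wws.
apply: cycle_from_next; first exact: uniq_word wws.
by move=> x xw; have [nE _] := next_permE uws; rewrite /= (nE _ _ wws xw).
Qed.

End NextPerm.

(** Labels may repeat, so [g] has no inverse; but each [v] is a rotation of some [map g w], and
    rotating [w] itself gives a lift. Thus links that differ by rotations, reordering or heights can
    share letters and successor permutation. *)
Lemma lift_cyc (T A : choiceType) (g : T -> A) (ws : seq (seq T)) (vs : seq (seq A)) :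
  perm_eq [seq cyc (map g w) | w <- ws] [seq cyc v | v <- vs] ->
  exists2 ws', vs = map (map g) ws' & perm_eq (map (@cyc T) ws) (map (@cyc T) ws').
Proof.
elim: vs ws => [|v vs IH] ws.
  by move=> /perm_size; case: ws => // _; exists [::].
move=> h; have : cyc v \in [seq cyc (map g w) | w <- ws].
  by rewrite (perm_mem h) mem_head.
case/mapP=> w wws /esym/eqP/cycP[n vE]; rewrite -map_rot in vE.
have pw := perm_to_rem wws.
have /IH[ws' -> pw'] :
    perm_eq [seq cyc (map g w) | w <- rem w ws] [seq cyc v | v <- vs].
  rewrite -(perm_cons (cyc v)) -[cyc v :: _ in X in perm_eq _ X]/[seq cyc v | v <- v :: vs].
  rewrite -(permPr h) perm_sym (permPl (perm_map _ pw)) /=.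
  suff -> : cyc v = cyc (map g w) by [].
  by apply/esym/eqP/cycP; exists n; rewrite vE map_rot.
exists (rot n w :: ws'); first by rewrite vE.
rewrite (permPl (perm_map _ pw)) /=.
suff -> : cyc (rot n w) = cyc w by rewrite perm_cons.
by apply/esym/eqP/cycP; exists n.
Qed.

(** * Links presented by labelled letters *)

Section Models.
Variables (R : realType) (Q : quiver).
Local Notation Ch := {poly R[i]}.
Implicit Types (X Y : prelink Q).

Definition vertex_monom (vs : seq (vertex Q)) : {cmonom Lbasis Q} :=
  \big[mmul/mone]_(v <- vs) ucm (inr v : Lbasis Q).

Lemma perm_vertex_monom vs vs' : perm_eq vs vs' -> vertex_monom vs = vertex_monom vs'.
Proof. exact: perm_big. Qed.

Definition decorate (T : Type) (lab : T -> arrow Q) (ht : T -> nat) :=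
  map (map (fun x => (lab x, ht x))).

(** A presentation of [X] on letters of any finite type. A contracted link is presented on the
    letters of the original one, with a smaller [P]. *)
Definition model (T : finType) (lab : T -> arrow Q) (ht : T -> nat)
    (P : {set T}) (f : {perm T}) ws s X : Prop :=
  [/\ X.1 = decorate lab ht ws, spells P f ws, coherent lab P (f, set0),
      perm_eq s (flatten ws) & sorted ltn (map ht s)].

Definition letter X : 'I_(size (flatten X.1)) -> arrow Q * nat :=
  tnth (in_tuple (flatten X.1)).

Definition positions X := enum 'I_(size (flatten X.1)).
Definition position_words X := reshape (shape X.1) (positions X).
Definition sorted_positions X :=
  sort (fun i j => (@letter X i).2 <= (@letter X j).2)%N (positions X).

Definition link_symbol X : SLh Q R :=
  symbol 'X (fun i => (@letter X i).1) setT (vertex_monom X.2)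
    (sorted_positions X) (next_perm (position_words X), set0).

Lemma coherent_closed (T : finType) (lab : T -> arrow Q) (P : {set T}) f ws :
  spells P f ws -> (forall w, w \in ws -> closed_path (map lab w)) ->
  coherent lab P (f, set0).
Proof.
move=> sp cl x; have [uws wsP ws0 cws] := sp.
rewrite -wsP => /flattenP[w wws xw] /=; rewrite (spells_nextE sp wws xw); split.
  by rewrite -wsP; apply/flattenP; exists w; rewrite ?mem_next.
have /andP[_] := cl _ wws; rewrite cycle_map => /next_cycle/(_ xw) /= /eqP <-.
by rewrite /letter_end inE.
Qed.

Lemma closed_coherent (T : finType) (lab : T -> arrow Q) (P : {set T}) f ws w :
  spells P f ws -> coherent lab P (f, set0) -> w \in ws -> closed_path (map lab w).
Proof.
move=> sp co wws; have [uws wsP ws0 cws] := sp.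
apply/andP; split.
  by apply: contraNneq ws0 => /eqP; rewrite -size_eq0 size_map size_eq0 => /eqP <-.
rewrite cycle_map; apply: cycle_from_next; first exact: uniq_word wws.
move=> x xw /=; rewrite -(spells_nextE sp wws xw).
have xP : x \in P by rewrite -wsP; apply/flattenP; exists w.
by have [_ /= ->] := co x xP; rewrite /letter_end inE.
Qed.

Lemma unzip1_decorate (T : Type) (lab : T -> arrow Q) ht ws :
  map (@unzip1 _ _) (decorate lab ht ws) = map (map lab) ws.
Proof.
by rewrite /decorate -map_comp; apply: eq_map => w /=; rewrite /unzip1 -map_comp.
Qed.

Lemma heights_decorate (T : Type) (lab : T -> arrow Q) ht ws vs :
  heights (decorate lab ht ws, vs) = map ht (flatten ws).
Proof. by rewrite /heights /decorate /= -map_flatten -map_comp. Qed.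

Lemma heightsE X : heights X = heights (X.1, X.2).
Proof. by case: X. Qed.

Section ModelTheory.
Variables (T : finType) (lab : T -> arrow Q) (ht : T -> nat).
Variables (P : {set T}) (f : {perm T}) (ws : seq (seq T)) (s : seq T) (X : prelink Q).
Hypothesis mX : model lab ht P f ws s X.

Lemma model_uniq_heights : uniq (map ht s).
Proof. by case: mX => _ _ _ _; apply: sorted_uniq ltn_trans ltnn _. Qed.

Lemma model_heights : perm_eq (map ht s) (heights X).
Proof. by case: mX => X1 _ _ ps _; rewrite heightsE X1 heights_decorate perm_map. Qed.

Lemma model_wf : link_wf X.
Proof.
apply/andP; split; last by rewrite -(perm_uniq model_heights) model_uniq_heights.
case: mX => X1 sp co _ _; rewrite X1 -(all_map (@unzip1 _ _) (@closed_path Q)).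
rewrite unzip1_decorate all_map; apply/allP => w; exact: closed_coherent sp co.
Qed.

Lemma model_mem x : (x \in s) = (x \in P).
Proof. by case: mX => _ [_ <- _ _] _ /perm_mem->. Qed.

Lemma model_uniq : uniq s.
Proof. by case: mX => _ [uw _ _ _] _ /perm_uniq->. Qed.

Lemma model_inj : {in P &, injective ht}.
Proof.
move=> x y; rewrite -!model_mem => xs ys hxy.
have [z _] : exists z, z \in s by exists x.
rewrite -(nth_index z xs) -(nth_index z ys); congr nth; apply/eqP.
rewrite -(nth_uniq 0%N _ _ model_uniq_heights) ?size_map ?index_mem //.
by rewrite !(nth_map z) ?index_mem // !nth_index // hxy.
Qed.

(** [link_symbol] is defined on the canonical letters, the positions in the flattened words. The
    injection [i] sends each position to the letter of [ws] at the same place and carries the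
    canonical presentation to the given one. *)
Lemma model_symbol : link_symbol X = symbol 'X lab P (vertex_monom X.2) s (f, set0).
Proof.
have [X1 sp co ps ss] := mX; have [uws wsP ws0 cws] := sp.
have sizeE : size (flatten ws) == size (flatten X.1).
  by rewrite X1 /decorate -map_flatten size_map.
pose tw : (size (flatten X.1)).-tuple T := Tuple sizeE.
pose i := tnth tw.
have inj_i : injective i.
  move=> j k; have x0 := tnth tw j; rewrite /i !(tnth_nth x0) /= => /eqP.
  by rewrite nth_uniq ?(eqP sizeE) // => /eqP/val_inj.
have ienum : map i (positions X) = flatten ws by rewrite map_tnth_enum.
have letterE j : @letter X j = (lab (i j), ht (i j)).
  have x0 := i j; rewrite /letter /i (tnth_nth (lab x0, ht x0)) (tnth_nth x0) /=.
  have: (j < size (flatten ws))%N by rewrite (eqP sizeE).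
  by move: (nat_of_ord j) => k ltk; rewrite X1 /decorate -map_flatten (nth_map x0).
have posK : flatten (position_words X) = positions X.
  by rewrite reshapeKr // size_enum_ord size_flatten.
have iwords : map (map i) (position_words X) = ws.
  rewrite /position_words map_reshape ienum X1 /decorate /shape -map_comp.
  rewrite (eq_map (g := size)) ?flattenK // => w /=; exact: size_map.
have sp' : spells setT (next_perm (position_words X)) (position_words X).
  apply: spells_next_perm; rewrite ?posK ?enum_uniq //.
    by move=> j; rewrite /positions mem_enum !inE.
  by apply: contra ws0 => h; rewrite -iwords; apply/mapP; exists [::].
have iT : i @: setT = P.
  apply/setP=> x; rewrite -wsP -ienum; apply/imsetP/mapP => -[j _ ->];
    by exists j; rewrite ?mem_enum ?inE.
have fi j : f (i j) = i (next_perm (position_words X) j).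
  have [w wX jw] : exists2 w, w \in position_words X & j \in w.
    by apply/flattenP; rewrite posK mem_enum.
  rewrite (spells_nextE sp' wX jw).
  have uw : uniq w by apply: uniq_word wX; rewrite posK enum_uniq.
  rewrite -(next_map inj_i uw) (spells_nextE sp (w := map i w)) ?map_f //.
  by rewrite -iwords map_f.
(* The heights are distinct, so the order is strict and a sorted list is determined by its
   elements. *)
have sE : map i (sorted_positions X) = s.
  apply: (@irr_sorted_eq _ (relpre ht ltn)).
  - by move=> y x z; apply: ltn_trans.
  - by move=> x; apply: ltnn.
  - rewrite -sorted_map ltn_sorted_uniq_leq; apply/andP; split.
      rewrite -map_comp map_inj_in_uniq ?sort_uniq ?enum_uniq //.
      move=> j k _ _ /= /model_inj h.
      by apply: inj_i; apply: h; rewrite -iT imset_f.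
    rewrite -map_comp sorted_map /sorted_positions.
    rewrite (eq_sorted (e' := fun j k => (@letter X j).2 <= (@letter X k).2)%N).
      by apply: sort_sorted => j k; apply: leq_total.
    by move=> j k /=; rewrite !letterE.
  - by rewrite -sorted_map.
  move=> x; rewrite (perm_mem ps) -ienum; apply/mapP/mapP => -[j jX ->]; exists j => //;
    by rewrite ?mem_sort mem_enum.
have labE : (fun j => (@letter X j).1) = lab \o i.
  by apply/funext => j /=; rewrite letterE.
rewrite /link_symbol labE -sE -iT; apply: esym; apply: symbol_transport => //=.
- by rewrite iT.
- by move=> x; rewrite !inE.
Qed.

End ModelTheory.

Lemma model_exists X : link_wf X ->
  model (fun i => (@letter X i).1) (fun i => (@letter X i).2) setT
    (next_perm (position_words X)) (position_words X) (sorted_positions X) X.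
Proof.
move=> /andP[cl uh].
have posK : flatten (position_words X) = positions X.
  by rewrite reshapeKr // size_enum_ord size_flatten.
have XE : X.1 = decorate (fun i => (@letter X i).1) (fun i => (@letter X i).2)
    (position_words X).
  rewrite /decorate (eq_map (g := map (@letter X))); last first.
    by move=> w; apply: eq_map => j; rewrite -surjective_pairing.
  by rewrite /position_words map_reshape map_tnth_enum flattenK.
have w0 : [::] \notin position_words X.
  apply/negP => h; have : [::] \in X.1 by rewrite XE; apply/mapP; exists [::].
  by move/(allP cl).
have sp : spells setT (next_perm (position_words X)) (position_words X).
  apply: spells_next_perm; rewrite ?posK ?enum_uniq // => j.
  by rewrite /positions mem_enum !inE.
split=> //.
- apply: coherent_closed sp _ => w wX.
  apply: (allP (a := @closed_path Q) _ _ (map_f _ wX)).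
  rewrite -(unzip1_decorate _ (fun i => (@letter X i).2)) -XE all_map; exact: cl.
- by rewrite posK perm_sort.
rewrite ltn_sorted_uniq_leq; apply/andP; split.
  rewrite (perm_uniq (s2 := heights X)) //.
  have -> : heights X = map (fun i => (@letter X i).2) (positions X).
    rewrite -posK -(heights_decorate (fun i => (@letter X i).1) _ _ X.2).
    by rewrite -XE -heightsE.
  by apply: perm_map; rewrite perm_sort.
by rewrite sorted_map; apply: sort_sorted => j k; apply: leq_total.
Qed.

(** The identifications between heighted links touch only the heights and the listing of the words.
    All that enters the symbol, including the order [s], is kept. *)
Lemma model_equiv (T : finType) (lab : T -> arrow Q) ht (P : {set T}) f ws s X Y :
  model lab ht P f ws s X -> link_equiv X Y ->
  exists ht' ws', model lab ht' P f ws' s Y.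
Proof.
move=> mX [h [hmono pXY vXY]]; have [X1 sp co ps ss] := mX.
have E : [seq cyc (reheight h w) | w <- X.1]
    = [seq cyc (map (fun x => (lab x, h (ht x))) w) | w <- ws].
  rewrite X1 /decorate -map_comp; apply: eq_map => w /=; by rewrite /reheight -map_comp.
rewrite E in pXY; have [ws' Y1 pws] := lift_cyc pXY.
exists (fun x => h (ht x)), ws'; split=> //.
- exact: spells_cyc sp.
- exact: perm_trans ps (perm_flatten_cyc pws).
rewrite sorted_map; move: ss; rewrite sorted_map => ss.
apply: (@sub_in_sorted _ (mem s) (relpre ht ltn)) ss; last exact/allP.
by move=> x y xs ys /= xy; rewrite hmono // -(perm_mem (model_heights mX)) map_f.
Qed.

Lemma link_symbol_equiv X Y : link_wf X -> link_equiv X Y ->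
  link_symbol X = link_symbol Y.
Proof.
move=> wX XY; have mX := model_exists wX; have [ht' [ws' mY]] := model_equiv mX XY.
rewrite (model_symbol mX) (model_symbol mY).
by have [_ [_ _ vXY]] := XY; rewrite (perm_vertex_monom vXY).
Qed.

End Models.

(** * Compatibility with the relations *)

Lemma porbit_fconnect (T : finType) (f : {perm T}) x y :
  (y \in porbit f x) = fconnect f x y.
Proof.
apply/porbitP/idP => [[n ->]|/iter_findex <-]; first by rewrite permX fconnect_iter.
by exists (findex f x y); rewrite permX.
Qed.

Lemma porbit_spells (T : finType) (P : {set T}) (f : {perm T}) ws w x y :
  spells P f ws -> w \in ws -> x \in w -> (y \in porbit f x) = (y \in w).
Proof.
move=> [_ _ _ cws] wws xw; rewrite porbit_fconnect.
by rewrite (fconnect_cycle (cws _ wws) xw).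
Qed.

Section Relations.
Variables (R : realType) (Q : quiver).
Local Notation Ch := {poly R[i]}.
Local Notation link_symbol := (@link_symbol R Q).

Lemma cons_wordE (T : finType) (w : seq T) ws : w != [::] -> cons_word w ws = w :: ws.
Proof. by case: w. Qed.

Section Model.
Variables (T : finType) (lab : T -> arrow Q) (ht : T -> nat) (P : {set T}).
Variables (f : {perm T}) (ws : seq (seq T)) (X : prelink Q).
Implicit Types (p q : T) (s : seq T).

Lemma adjacent_split s p q : model lab ht P f ws s X -> p \in P -> q \in P ->
  adjacent_heights X (ht p) (ht q) -> exists s1 s2, s = s1 ++ p :: q :: s2.
Proof.
move=> mX; rewrite -!(model_mem mX) => ps qs /andP[ltpq /allP adj].
have {}adj r : r \in s -> (ht r <= ht p)%N || (ht q <= ht r)%N.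
  by move=> rs; apply: adj; rewrite -(perm_mem (model_heights mX)) map_f.
have [_ _ _ _] := mX; rewrite (sorted_pairwise ltn_trans) pairwise_map.
case/splitPr: ps adj qs => s1 s2 adj.
rewrite mem_cat inE pairwise_cat /= => qs /and3P[/allrelP h12 _ /andP[/allP hp h2]].
case/or3P: qs => [qs1|/eqP qp|qs2].
- by have /= := h12 q p qs1 (mem_head _ _); rewrite ltnNge ltnW.
- by move: ltpq; rewrite qp ltnn.
case: s2 => [|r s2] // in adj h12 hp h2 qs2 *; exists s1, s2.
move: qs2; rewrite inE => /predU1P[-> //|qs2].
have := adj r; rewrite mem_cat !inE eqxx !orbT leqNgt => /(_ isT).
have /= -> /= := hp r (mem_head _ _).
by move: h2 => /= /andP[/allP /(_ q qs2) /= ltrq _]; rewrite leqNgt ltrq.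
Qed.

Lemma model_swap s1 s2 p q vs : model lab ht P f ws (s1 ++ p :: q :: s2) X ->
  model lab (ht \o tperm p q) P f ws (s1 ++ q :: p :: s2)
    (decorate lab (ht \o tperm p q) ws, vs).
Proof.
move=> mX; have [X1 sp co ps ss] := mX.
have uq := model_uniq mX.
have pm : perm_eq (s1 ++ q :: p :: s2) (s1 ++ p :: q :: s2).
  by apply/seq.permP => a; rewrite !count_cat /=; lia.
split=> //; first exact: perm_trans pm ps.
suff -> : map (ht \o tperm p q) (s1 ++ q :: p :: s2)
    = map ht (s1 ++ p :: q :: s2) by [].
move: uq; rewrite cat_uniq /= !negb_or => /and5P[_ /and3P[p1 q1 _] /andP[npq p2] q2 _].
rewrite !map_cat /= tpermL tpermR; congr (_ ++ _ :: _ :: _); apply/eq_in_map => x xs /=;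
  rewrite tpermD //; by [apply: contraNneq p1 => -> | apply: contraNneq q1 => ->
    | apply: contraNneq p2 => -> | apply: contraNneq q2 => ->].
Qed.

(** The exponent is 1 exactly when the two letters lie in one word, which explains why only the
    splitting relation carries the parameter. *)
Lemma relation_symbol s1 s2 p q (ht' : T -> nat) X' :
  model lab ht P f ws (s1 ++ p :: q :: s2) X ->
  model lab ht' P f ws (s1 ++ q :: p :: s2) X' -> X'.2 = X.2 ->
  link_symbol X - link_symbol X'
  = ('X ^+ (p \in porbit f q) * bracket Ch (lab p) (lab q)) *:
    symbol 'X lab P (vertex_monom X.2) (s1 ++ s2) (contract p q (f, set0)).
Proof.
move=> mX mX' X2; rewrite (model_symbol R mX) (model_symbol R mX') X2.
have npq : p != q.
  move: (model_uniq mX); rewrite cat_uniq /= !negb_or.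
  by case/and5P=> _ _ /andP[].
apply: etrans (wick_swap _ _ _ _ _ _ _ _) _.
refine (f_equal (fun c => c *: _) _).
rewrite /weight !inE /= (negPf npq) eq_sym (negPf npq) porbit_sym -mulrBl mulrC.
by rewrite bracket_pairing.
Qed.

(** Removing both contracted letters leaves a state with nothing erased, which can be compared with
    the symbol of an actual link. *)
Lemma symbol_contract m s p q :
  p \in P -> q \in P -> p != q -> asrc (lab p) = atgt (lab q) ->
  asrc (lab q) = atgt (lab p) -> coherent lab P (f, set0) ->
  {subset s <= P :\ p :\ q} ->
  let f1 := (tperm p q * f)%g in let f2 := erase q (erase p f1) in
  symbol 'X lab P m s (contract p q (f, set0)) =
  symbol 'X lab (P :\ p :\ q)
    (free_vertex lab q (erase p f1) (free_vertex lab p f1 m)) s (f2, set0)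
  :> SLh Q R
  /\ coherent lab (P :\ p :\ q) (f2, set0).
Proof.
move=> pP qP npq pq qp co sP f1 f2.
have co1 : coherent lab P (contract p q (f, set0)).
  by apply: coherent_contract; rewrite ?inE.
have pE : p \in (contract p q (f, set0)).2 by rewrite !inE eqxx.
have co2 := coherent_erase pE pP co1.
have qE : q \in (contract p q (f, set0)).2 :\ p.
  by rewrite !inE eqxx eq_sym npq orbT.
have qP' : q \in P :\ p by rewrite !inE eq_sym npq.
have co3 := coherent_erase (st := (_, _)) qE qP' co2.
have E0 : ((contract p q (f, set0)).2 :\ p) :\ q = set0.
  by apply/setP=> x; rewrite !inE; do !case: eqP => //=.
rewrite /= E0 in co3; split=> //.
refine (etrans (symbol_erase _ _ pE pP co1 _) _); first by move=> x /sP/setD1P[].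
by refine (etrans (symbol_erase _ _ (st := (_, _)) qE qP' co2 sP) _); rewrite /= E0.
Qed.

End Model.

Lemma subseq_model (T : finType) (lab : T -> arrow Q) ht (P P' : {set T}) f f'
    ws ws' s s' X X' :
  model lab ht P f ws s X -> subseq s' s -> (forall x, (x \in s') = (x \in P')) ->
  spells P' f' ws' -> coherent lab P' (f', set0) -> X'.1 = decorate lab ht ws' ->
  model lab ht P' f' ws' s' X'.
Proof.
move=> mX ss sP sp co X1; have [uw wP _ _] := sp; have [_ _ _ _ so] := mX.
split=> //.
  apply: uniq_perm => //; first exact: subseq_uniq ss (model_uniq mX).
  by move=> x; rewrite sP wP.
by apply: (subseq_sorted ltn_trans _ so); apply: map_subseq.
Qed.


Lemma model_exists_finType (X : prelink Q) : link_wf X ->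
  exists (T : finType) (lab : T -> arrow Q) ht P f ws s, model lab ht P f ws s X.
Proof.
by move=> /model_exists mX; exists 'I_(size (flatten X.1)); do 6!eexists; apply: mX.
Qed.

Lemma decorate_swap (T : finType) (lab : T -> arrow Q) (ht : T -> nat) p q ws :
  p \notin flatten ws -> q \notin flatten ws ->
  decorate lab (ht \o tperm p q) ws = decorate lab ht ws.
Proof.
move=> pw qw; apply/eq_in_map => w wws; apply/eq_in_map => x xw /=.
by rewrite tpermD //; [apply: contraNneq pw | apply: contraNneq qw] => ->;
  apply/flattenP; exists w.
Qed.

Lemma decorate_swap_merge (T : finType) (lab : T -> arrow Q) (ht : T -> nat)
    p w q u ws :
  uniq (flatten ((p :: w) :: (q :: u) :: ws)) ->
  decorate lab (ht \o tperm p q) ((p :: w) :: (q :: u) :: ws)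
  = ((lab p, ht q) :: map (fun x => (lab x, ht x)) w) ::
    ((lab q, ht p) :: map (fun x => (lab x, ht x)) u) :: decorate lab ht ws.
Proof.
move=> uws; have pE : p \notin flatten (w :: u :: ws).
  move: uws; rewrite /= mem_cat inE !negb_or mem_cat !negb_or.
  by case/andP=> /and4P[? ? ? ?] _; rewrite !mem_cat !negb_or; apply/and3P.
have qE : q \notin flatten (w :: u :: ws).
  move: uws; rewrite /= cat_uniq /= => /and3P[_ _ /and3P[]].
  rewrite negb_or => /andP[qw _].
  by rewrite !mem_cat !negb_or => /andP[-> ->] _; rewrite qw.
have := decorate_swap lab ht pE qE; rewrite /decorate /= => -[E1 E2 E3].
by rewrite tpermL tpermR E1 E2 E3.
Qed.

Lemma decorate_swap_split (T : finType) (lab : T -> arrow Q) (ht : T -> nat)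
    p w q u ws :
  uniq (flatten ((p :: w ++ q :: u) :: ws)) ->
  decorate lab (ht \o tperm p q) ((p :: w ++ q :: u) :: ws)
  = ((lab p, ht q) :: map (fun x => (lab x, ht x)) w ++
     (lab q, ht p) :: map (fun x => (lab x, ht x)) u) :: decorate lab ht ws.
Proof.
move=> uws; have upq : uniq (p :: q :: w ++ u ++ flatten ws).
  move: uws; congr is_true; apply: perm_uniq; rewrite /= -?catA.
  by apply/seq.permP => c /=; rewrite !count_cat /= ?count_cat; clear; lia.
have pE : p \notin flatten (w :: u :: ws).
  by move: upq => /= /and3P[]; rewrite inE negb_or => /andP[].
have qE : q \notin flatten (w :: u :: ws).
  by move: upq => /= /and3P[].
have := decorate_swap lab ht pE qE; rewrite /decorate /= => -[E1 E2 E3].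
by rewrite map_cat /= tpermL tpermR E1 E2 E3.
Qed.

(** * The contracted link is the bracket term *)

Section Surgery.
Variables (T : finType) (lab : T -> arrow Q) (ht : T -> nat) (P : {set T}).
Variables (f : {perm T}) (p q : T) (w u : seq T) (ws : seq (seq T)).
Variables (s1 s2 : seq T) (vs : seq (vertex Q)).
Local Notation deco := (map (fun x => (lab x, ht x))).
Local Notation s := (s1 ++ p :: q :: s2).

Lemma uniq_adjacent_mem ws' X : model lab ht P f ws' s X ->
  [/\ p \in P, q \in P, p != q &
      forall x, (x \in s1 ++ s2) = (x \in P :\ p :\ q)].
Proof.
move=> mX; have sP := model_mem mX; have := model_uniq mX.
rewrite cat_uniq /= !negb_or => /and5P[_ /and3P[p1 q1 _] /andP[npq p2] q2 _].
have {}p2 : p \notin s2 := p2.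
split=> //; rewrite -?sP ?mem_cat ?inE ?eqxx ?orbT // => x.
rewrite !inE -sP !mem_cat !inE; case: (eqVneq x q) => [->|xq] /=.
  by rewrite (negPf q1) (negPf q2).
by case: (eqVneq x p) => [->|xp] //=; rewrite (negPf p1) (negPf p2).
Qed.

Lemma subseq_adjacent : subseq (s1 ++ s2) s.
Proof.
apply: cat_subseq => //; exact: subseq_trans (subseq_cons _ q) (subseq_cons _ p).
Qed.

Lemma merge_symbol : 
  model lab ht P f ((p :: w) :: (q :: u) :: ws) s
    (decorate lab ht ((p :: w) :: (q :: u) :: ws), vs) ->
  bracket Ch (lab p) (lab q) != 0 ->
  let X'' := add_component (atgt (lab p)) (deco w ++ deco u) (decorate lab ht ws, vs) in
  link_wf X'' /\
  symbol 'X lab P (vertex_monom vs) (s1 ++ s2) (contract p q (f, set0))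
    = link_symbol X''.
Proof.
move=> mX /bracket_neq0[pq qp] X''; have [X1 sp co ps ss] := mX.
have [pP qP npq sP] := uniq_adjacent_mem mX.
have sP' : {subset s1 ++ s2 <= P :\ p :\ q} by move=> x; rewrite sP.
have [E co''] := symbol_contract (vertex_monom vs) pP qP npq pq qp co sP'.
have sp1 := spells_merge sp.
have nuw : u ++ q :: w != [::] by case: (u).
have := spells_erase sp1; rewrite cons_wordE // => sp2.
(* The merged word is [p u q w]. Without [p], and rotated to bring [q] in front, it is [q w u];
   removing [q] leaves the word of the relation. *)
have {}sp2 : spells (P :\ p) (erase p (tperm p q * f)%g) ((q :: w ++ u) :: ws).
  apply: spells_cyc sp2; rewrite /= (_ : cyc (u ++ _) = cyc (q :: w ++ u)) //.
  by apply/eqP/cycP; exists (size u); rewrite rot_size_cat.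
have sp3 := spells_erase sp2.
have mX'' : model lab ht (P :\ p :\ q) (erase q (erase p (tperm p q * f)))%g
    (cons_word (w ++ u) ws) (s1 ++ s2) X''.
  apply: subseq_model mX subseq_adjacent sP sp3 co'' _.
  by rewrite /X'' -map_cat; case: (w ++ u).
split; first exact: model_wf mX''.
rewrite (model_symbol R mX''); refine (etrans E _).
refine (f_equal (fun m => symbol 'X lab _ m (s1 ++ s2) _) _).
(* The letter [p] is never alone, since [q] is in its word. A vertex appears only at [q], when [w]
   and [u] are both empty, and the source of [q] is the target of [p]. *)
rewrite /free_vertex (spells_fixed sp1) (negPf nuw) (spells_fixed sp2).
rewrite /X'' -map_cat; case: (w ++ u) => [|x v] //=.
by rewrite /vertex_monom big_cons mulmC qp.
Qed.

Lemma split_symbol :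
  model lab ht P f ((p :: w ++ q :: u) :: ws) s
    (decorate lab ht ((p :: w ++ q :: u) :: ws), vs) ->
  bracket Ch (lab p) (lab q) != 0 ->
  let X'' := add_component (atgt (lab q)) (deco u)
    (add_component (atgt (lab p)) (deco w) (decorate lab ht ws, vs)) in
  link_wf X'' /\
  symbol 'X lab P (vertex_monom vs) (s1 ++ s2) (contract p q (f, set0))
    = link_symbol X''.
Proof.
move=> mX /bracket_neq0[pq qp] X''; have [X1 sp co ps ss] := mX.
have [pP qP npq sP] := uniq_adjacent_mem mX.
have sP' : {subset s1 ++ s2 <= P :\ p :\ q} by move=> x; rewrite sP.
have [E co''] := symbol_contract (vertex_monom vs) pP qP npq pq qp co sP'.
have sp1 := spells_split sp.
have sp2 : spells (P :\ p) (erase p (tperm p q * f)%g) ((q :: w) :: cons_word u ws).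
  apply: spells_cyc (spells_erase sp1).
  case: (u) => [|x v] //=; apply/seq.permP => a /=; lia.
have sp3 : spells (P :\ p :\ q) (erase q (erase p (tperm p q * f)))%g
    (cons_word u (cons_word w ws)).
  apply: spells_cyc (spells_erase sp2).
  case: (u) (w) => [|x v] [|x' v'] //=; apply/seq.permP => a /=; lia.
have mX'' : model lab ht (P :\ p :\ q) (erase q (erase p (tperm p q * f)))%g
    (cons_word u (cons_word w ws)) (s1 ++ s2) X''.
  apply: subseq_model mX subseq_adjacent sP sp3 co'' _.
  by rewrite /X''; case: (u) (w) => [|x v] [|x' v'].
split; first exact: model_wf mX''.
rewrite (model_symbol R mX''); refine (etrans E _).
refine (f_equal (fun m => symbol 'X lab _ m (s1 ++ s2) _) _).
(* The new words are [p u] and [q w]. An empty [u] leaves the source of [p], the target of [q]; an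
   empty [w] leaves the source of [q], the target of [p]. *)
rewrite /free_vertex (spells_fixed sp1) (spells_fixed sp2) /X'' /vertex_monom.
case: (u) (w) => [|x v] [|x' v'] //=; rewrite ?big_cons ?pq ?qp //.
- by rewrite [X in mmul X _]mulmC -mulmA; congr mmul; rewrite mulmC.
- by rewrite mulmC.
- by rewrite mulmC.
Qed.

End Surgery.

Lemma map_eq_cat (A B : Type) (g : A -> B) (v : seq A) b1 b2 : b1 ++ b2 = map g v ->
  exists v1 v2, [/\ v = v1 ++ v2, b1 = map g v1 & b2 = map g v2].
Proof.
move=> E; exists (take (size b1) v), (drop (size b1) v); rewrite cat_take_drop.
by rewrite map_take map_drop -E take_size_cat // drop_size_cat.
Qed.

(** The contracted symbol [Z] makes sense for all pairs of letters, whereas [X''] may fail to be a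
    link when the bracket vanishes; so the two are identified only for a nonzero bracket. *)
Lemma merge_relation a h w b k u ws vs :
  let X := (((a, h) :: w) :: ((b, k) :: u) :: ws, vs) : prelink Q in
  let X' := (((a, k) :: w) :: ((b, h) :: u) :: ws, vs) : prelink Q in
  let X'' := add_component (atgt a) (w ++ u) (ws, vs) in
  link_wf X -> adjacent_heights X h k ->
  exists Z : SLh Q R, [/\ link_wf X',
    link_symbol X - link_symbol X' = bracket Ch a b *: Z
    & bracket Ch a b != 0 -> link_wf X'' /\ Z = link_symbol X''].
Proof.
move=> X X' X'' wX adj.
have [T [lab [ht [P [f [ws0 [s mX]]]]]]] := model_exists_finType wX.
have [] := mX; case: ws0 mX => [|[|p w0] [|[|q u0] ws1]] // mX [ea eh ew eb ek eu ews].
move=> sp co ps ss; have XE : X = (decorate lab ht ((p :: w0) :: (q :: u0) :: ws1), vs).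
  by rewrite /X ea eh ew eb ek eu ews.
have [uws wsP _ _] := sp.
have pP : p \in P by rewrite -wsP /= mem_head.
have qP : q \in P by rewrite -wsP /= !(inE, mem_cat) eqxx !orbT.
rewrite eh ek in adj; have [s1 [s2 sE]] := adjacent_split mX pP qP adj.
rewrite sE XE in mX *; have mX' := model_swap vs mX.
have X'E : X' = (decorate lab (ht \o tperm p q) ((p :: w0) :: (q :: u0) :: ws1), vs).
  by rewrite /X' ea eh eb ek ew eu ews (decorate_swap_merge _ _ uws).
have mX'w : link_wf X' by rewrite X'E; apply: model_wf mX'.
exists (symbol 'X lab P (vertex_monom vs) (s1 ++ s2) (contract p q (f, set0))).
split; [exact: mX'w | |].
  rewrite X'E ea eb; refine (etrans (relation_symbol mX mX' (erefl _)) _).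
  refine (f_equal (fun c => c *: _) _).
  have -> : (p \in porbit f q) = false.
    rewrite (porbit_spells _ sp (w := q :: u0)) ?mem_head ?inE ?eqxx ?orbT //.
    move: uws => /= /andP[]; rewrite !(mem_cat, inE) !negb_or -?andbA.
    by case/and4P=> _ /negPf-> /negPf-> _.
  by rewrite expr0 mul1r.
rewrite ea eb => nb; have [] := merge_symbol mX nb.
by rewrite /X'' ea ew eu ews.
Qed.

Lemma split_relation a h w b k u ws vs :
  let X := (((a, h) :: w ++ (b, k) :: u) :: ws, vs) : prelink Q in
  let X' := (((a, k) :: w ++ (b, h) :: u) :: ws, vs) : prelink Q in
  let X'' := add_component (atgt b) u (add_component (atgt a) w (ws, vs)) in
  link_wf X -> adjacent_heights X h k ->
  exists Z : SLh Q R, [/\ link_wf X',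
    link_symbol X - link_symbol X' = ('X * bracket Ch a b) *: Z
    & bracket Ch a b != 0 -> link_wf X'' /\ Z = link_symbol X''].
Proof.
move=> X X' X'' wX adj.
have [T [lab [ht [P [f [ws0 [s mX]]]]]]] := model_exists_finType wX.
have [] := mX; case: ws0 mX => [|[|p v] ws1] // mX [ea eh ev ews].
have [w0 [[|q u0] [vE ew // [eb ek eu]]]] := map_eq_cat ev; rewrite {}vE in mX *.
move=> sp co ps ss; have XE : X = (decorate lab ht ((p :: w0 ++ q :: u0) :: ws1), vs).
  by rewrite /X ea eh ew eb ek eu ews /= map_cat.
have [uws wsP _ _] := sp.
have pP : p \in P by rewrite -wsP /= mem_head.
have qP : q \in P by rewrite -wsP /= !(inE, mem_cat) eqxx !orbT.
rewrite eh ek in adj; have [s1 [s2 sE]] := adjacent_split mX pP qP adj.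
rewrite sE XE in mX *; have mX' := model_swap vs mX.
have X'E : X' = (decorate lab (ht \o tperm p q) ((p :: w0 ++ q :: u0) :: ws1), vs).
  by rewrite /X' ea eh eb ek ew eu ews (decorate_swap_split _ _ uws).
have mX'w : link_wf X' by rewrite X'E; apply: model_wf mX'.
exists (symbol 'X lab P (vertex_monom vs) (s1 ++ s2) (contract p q (f, set0))).
split; [exact: mX'w | |].
  rewrite X'E ea eb; refine (etrans (relation_symbol mX mX' (erefl _)) _).
  refine (f_equal (fun c => c *: _) _).
  rewrite (porbit_spells _ sp (w := p :: w0 ++ q :: u0)) ?mem_head //.
  by rewrite !(inE, mem_cat) eqxx !orbT.
rewrite ea eb => nb; have [] := split_symbol mX nb.
by rewrite /X'' ea eb ew eu ews.
Qed.

End Relations.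

(** * Linear extensions and unitriangular maps *)

Section LinearExtension.
Variables (K : comNzRingType) (I : choiceType) (V : lmodType K) (b : I -> V).

Definition lin_ext (x : {malg K[I]}) : V := \sum_(k <- msupp x) x@_k *: b k.

Lemma lin_extEw (d : {fset I}) x : (msupp x `<=` d)%fset ->
  lin_ext x = \sum_(k <- d) x@_k *: b k.
Proof.
move=> le_xd; rewrite /lin_ext (big_fset_incl _ le_xd) //= => k _ /mcoeff_outdom ->.
by rewrite scale0r.
Qed.

Fact lin_ext_linear : linear lin_ext.
Proof.
move=> a x y; pose d := (msupp x `|` msupp y `|` msupp (a *: x + y)%R)%fset.
rewrite !(@lin_extEw d) ?fsubsetUr //; last 2 first.
- by rewrite /d -fsetUA fsetUCA fsubsetUl.
- by rewrite /d -fsetUA fsubsetUl.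
rewrite scaler_sumr -big_split /=; apply: eq_bigr => k _.
by rewrite mcoeffD mcoeffZ scalerDl scalerA.
Qed.
HB.instance Definition _ :=
  GRing.isLinear.Build K {malg K[I]} V *:%R lin_ext lin_ext_linear.

Lemma lin_extU k : lin_ext << k >> = b k.
Proof.
by rewrite (@lin_extEw [fset k]%fset) ?msuppU_le // big_seq_fset1 mcoeffUU scale1r.
Qed.

End LinearExtension.

Lemma malg_sumU (K : comNzRingType) (I : choiceType) (x : {malg K[I]}) :
  x = \sum_(k <- msupp x) x@_k *: << k >>.
Proof.
rewrite {1}[x]monalgE; apply: eq_bigr => k _.
by apply/malgP => j; rewrite mcoeffZ !mcoeffU mulr_natr.
Qed.

Section ModquotLift.
Variables (K : comNzRingType) (V W : lmodType K) (S : V -> Prop).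
Variable F : {linear V -> W}.
Hypothesis F0 : forall g, S g -> F g = 0.

Lemma mspan_lift x : mspan S x -> F x = 0.
Proof.
elim=> [|a g u Sg _ IH]; first exact: linear0.
by rewrite linearP F0 // IH scaler0 addr0.
Qed.

(** The vanishing proof is an argument of the map, so that the linear structure that rests on it can
    be inferred from the term. *)
Definition modquot_lift of (forall g, S g -> F g = 0) := fun u : modquot S =>
  F (sval (cid (modproj_surj u))).
Local Notation lift := (modquot_lift F0).

Lemma modquot_liftE x : lift (modproj S x) = F x.
Proof.
rewrite /modquot_lift; case: cid => y /= /eqP/modprojP/mspan_lift /eqP.
by rewrite linearB subr_eq0 => /eqP.
Qed.

Fact modquot_lift_linear : linear lift.
Proof.
move=> a u v; have [x ->] := modproj_surj u; have [y ->] := modproj_surj v.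
by rewrite -linearP !modquot_liftE linearP.
Qed.
HB.instance Definition _ :=
  GRing.isLinear.Build K (modquot S) W *:%R lift modquot_lift_linear.

End ModquotLift.

Lemma bijective_of_inj_surj (A B : Type) (g : A -> B) :
  injective g -> (forall y, exists x, g x = y) -> bijective g.
Proof.
move=> inj surj; exists (fun y => sval (cid (surj y))) => [x|y]; case: cid => //= z.
by move/inj.
Qed.

Section Unitriangular.
Variables (R : realType) (Q : quiver).
Local Notation Ch := {poly R[i]}.
Variable U : {linear SLh Q R -> SLh Q R}.
Hypothesis U_tri : forall m, narrows_lt (narrows m) (U << m >> - << m >>).

Lemma SLh_sumU (x : SLh Q R) : x = \sum_(k <- msupp x) x@_k *: (<< k >> : SLh Q R).
Proof. exact: malg_sumU. Qed.

Lemma SLh_coeffZ (a : Ch) (x : SLh Q R) m : (a *: x)@_m = a * x@_m.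
Proof. exact: mcoeffZ. Qed.

Lemma SLh_coeffD (x y : SLh Q R) m : (x + y)@_m = x@_m + y@_m.
Proof. exact: mcoeffD. Qed.

Lemma SLh_coeff_sum (I : Type) (r : seq I) (F : I -> SLh Q R) m :
  (\sum_(i <- r) F i)@_m = \sum_(i <- r) (F i)@_m.
Proof. exact: raddf_sum. Qed.

(** At a monomial of [x] with the most arrows, no correction term contributes, so [U x] has the same
    coefficient there as [x]. *)
Lemma unitri_inj x : U x = 0 -> x = 0.
Proof.
move=> Ux; apply/eqP/contraT => nx; exfalso.
have [m mx max_m] : exists2 m, m \in msupp x &
    forall k, k \in msupp x -> (narrows k <= narrows m)%N.
  move: nx; rewrite -msupp_eq0 => /fset0Pn[k0 k0x].
  have [n leN] : exists n, forall k, k \in msupp x -> (narrows k <= n)%N.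
    exists (\max_(k <- msupp x) narrows k)%N => k kx; exact: leq_bigmax_seq.
  have ex : exists n, `[< exists2 k, k \in msupp x & narrows k = n >].
    by exists (narrows k0); apply/asboolP; exists k0.
  have ub i : `[< exists2 k, k \in msupp x & narrows k = i >] -> (i <= n)%N.
    by move/asboolP => [k kx <-]; apply: leN.
  case: (ex_maxnP ex ub) => i /asboolP[m mx <-] maxi; exists m => // k kx.
  by apply: maxi; apply/asboolP; exists k.
move: mx; rewrite -mcoeff_neq0 => /eqP; apply.
have <- : (U x)@_m = 0 by rewrite Ux; apply: mcoeff0.
rewrite {2}[x]SLh_sumU linear_sum SLh_coeff_sum {1}[x]SLh_sumU SLh_coeff_sum.
rewrite !big_seq; apply: eq_bigr => k kx.
have Uk : (U << k >> - << k >>)@_m = 0.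
  apply: mcoeff_outdom; apply/negP => /U_tri; by rewrite ltnNge max_m.
have {}Uk : (U << k >>)@_m = (<< k >> : SLh Q R)@_m.
  by rewrite -[U _](subrK (<< k >> : SLh Q R)) SLh_coeffD Uk add0r.
apply: esym; refine (etrans (f_equal (mcoeff m) (linearZZ U _ _)) _).
refine (etrans (SLh_coeffZ _ _ _) _).
refine (etrans _ (esym (SLh_coeffZ _ _ _))).
exact: (f_equal (fun z => x@_k * z) Uk).
Qed.

Lemma unitri_surj y : exists x, U x = y.
Proof.
have im0 : exists x, U x = 0 by exists 0; rewrite linear0.
have imP a y1 y2 : (exists x, U x = y1) -> (exists x, U x = y2) ->
    exists x, U x = a *: y1 + y2.
  by move=> [x1 <-] [x2 <-]; exists (a *: x1 + x2); rewrite linearP.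
have im_sum (z : SLh Q R) : (forall k, k \in msupp z -> exists x, U x = << k >>) ->
    exists x, U x = z.
  move=> h; rewrite [z]SLh_sumU big_seq; elim/big_rec: _ => // k u kz IH.
  exact: imP (h _ kz) IH.
apply: (im_sum) => m _; have [n] := ubnP (narrows m).
elim: n m => // n IH m lem.
(* The correction term has only monomials with fewer arrows, so it is in the image by induction;
   subtracting it leaves [m]. *)
have [x Ux] : exists x, U x = U << m >> - << m >>.
  apply: (im_sum) => k /U_tri ltk; apply: IH; exact: leq_trans ltk _.
by exists (<< m >> - x); rewrite linearB Ux /= subKr.
Qed.

End Unitriangular.

(** * Descent of the symbol to the quotient *)

Section Symbol.
Variables (R : realType) (Q : quiver).
Local Notation Ch := {poly R[i]}.

Lemma hlE (X : prelink Q) (wX : link_wf X) :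
  hl R X = << \pi_(hlink Q) (Sub X wX : wlink Q) >> :> Atilde Q R.
Proof. by rewrite /hl insubT. Qed.

Lemma hl0 (X : prelink Q) : ~~ link_wf X -> hl R X = 0.
Proof. by move=> nX; rewrite /hl insubN. Qed.

Lemma pi_equiv (X Y : wlink Q) :
  \pi_(hlink Q) X = \pi_(hlink Q) Y <-> link_equiv (val X) (val Y).
Proof. by split=> [/eqmodP/asboolP|/asboolP h]; last apply/eqmodP. Qed.

Lemma hl_equiv (X Y : prelink Q) : link_wf X -> link_wf Y -> link_equiv X Y ->
  hl R X = hl R Y.
Proof.
move=> wX wY XY; rewrite !hlE; congr (<< _ >>).
by apply/pi_equiv.
Qed.

Definition hlink_symbol (X : hlink Q) : SLh Q R := link_symbol R (val (repr X)).

Lemma hlink_symbol_pi (X : wlink Q) :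
  hlink_symbol (\pi_(hlink Q) X) = link_symbol R (val X).
Proof.
apply: link_symbol_equiv; first exact: valP.
by apply/pi_equiv; rewrite reprK.
Qed.

Definition symbol_map : {linear Atilde Q R -> SLh Q R} := lin_ext hlink_symbol.

Lemma symbol_map_hl (X : prelink Q) : link_wf X ->
  symbol_map (hl R X) = link_symbol R X.
Proof. by move=> wX; rewrite hlE /= lin_extU hlink_symbol_pi SubK. Qed.

Lemma symbol_mapZ (c : Ch) (z : Atilde Q R) : symbol_map (c *: z) = c *: symbol_map z.
Proof. exact: linearZZ. Qed.

Lemma symbol_map_relation g : link_relation g -> symbol_map g = 0.
Proof.
have subZ (x y z : Atilde Q R) (c : Ch) :
    symbol_map (x - y - c *: z) = symbol_map x - symbol_map y - c *: symbol_map z.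
  by rewrite !(linearB symbol_map) symbol_mapZ.
case=> [a h w b k u ws vs X X' wX adj|a h w b k u ws vs X X' wX adj].
  have [Z [wX' E EZ]] := merge_relation R wX adj.
  have -> : symbol_map (hl R X - hl R X' - bracket Ch a b *:
      hl R (add_component (atgt a) (w ++ u) (ws, vs)))
    = bracket Ch a b *: Z - bracket Ch a b *:
      symbol_map (hl R (add_component (atgt a) (w ++ u) (ws, vs))).
    by rewrite subZ (symbol_map_hl wX) (symbol_map_hl wX') -E.
  (* For a zero bracket the third link may be ill formed, but both remaining terms have coefficient
     zero. *)
  have [->|/EZ[wX'' ->]] := eqVneq (bracket Ch a b) 0; first by rewrite !scale0r subrr.
  by rewrite symbol_map_hl // subrr.
have [Z [wX' E EZ]] := split_relation R wX adj.
set X'' := add_component _ _ _.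
have -> : symbol_map (hl R X - hl R X' - 'X *: (bracket Ch a b *: hl R X''))
    = ('X * bracket Ch a b) *: Z - ('X * bracket Ch a b) *: symbol_map (hl R X'').
  by rewrite subZ (symbol_map_hl wX) (symbol_map_hl wX') -E symbol_mapZ scalerA.
have [->|/EZ[wX'' ->]] := eqVneq (bracket Ch a b) 0.
  by rewrite mulr0 !scale0r subrr.
by rewrite symbol_map_hl // subrr.
Qed.

Definition quotient_symbol : {linear Alinks Q R -> SLh Q R} :=
  modquot_lift symbol_map_relation.

Lemma quotient_symbolE x : quotient_symbol (Alinks_proj Q R x) = symbol_map x.
Proof. exact: modquot_liftE. Qed.

End Symbol.

(** * Forgetting the heights *)

Section Forget.
Variables (R : realType) (Q : quiver).
Local Notation Ch := {poly R[i]}.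

Lemma components_monom (X : prelink Q) :
  \big[mmul/mone]_(b <- components X) ucm b
  = mmul (\big[mmul/mone]_(w <- X.1) necklace_monom (unzip1 w)) (vertex_monom X.2).
Proof.
rewrite /components big_cat !big_map; congr mmul.
elim: X.1 => [|w ws IH] /=; first by rewrite !big_nil.
rewrite big_cons -IH /necklace_monom; case: insubP => [c _ _|_] /=.
  by rewrite big_cons.
by rewrite mul1m.
Qed.

Lemma model_forget (T : finType) (lab : T -> arrow Q) ht (P : {set T}) f ws s
    (X : wlink Q) :
  model lab ht P f ws s (val X) ->
  read Ch lab P (vertex_monom (val X).2) (f, set0) = << forget_wlink X >> :> SLh Q R
  /\ narrows (forget_wlink X) = #|P|.
Proof.
move=> [X1 sp co ps ss]; have [uws wsP ws0 cws] := sp.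
rewrite /forget_wlink components_monom X1 big_map.
have wE w : necklace_monom (unzip1 (map (fun x => (lab x, ht x)) w))
    = necklace_monom (map lab w).
  by rewrite /unzip1 -map_comp.
split.
  refine (etrans (read_spells Ch co _ sp) _); rewrite [in RHS]mulmC.
  refine (f_equal (fun m => << mmul _ m >>) _).
  apply: eq_big_seq => w wws; rewrite wE /read_word /surviving.
  rewrite (eq_filter (a2 := predT)) ?filter_predT; last by move=> x; rewrite inE.
  by case: w wws => // h; rewrite h in ws0.
rewrite narrowsM /vertex_monom !narrows_prod [X in (_ + X)%N]big1 ?addn0; last first.
  by move=> v _; rewrite narrowsU.
rewrite (eq_big_seq size); last first.
  move=> w wws; rewrite wE narrows_necklace (closed_coherent sp co wws).
  by rewrite size_map.
have -> : #|P| = size (flatten ws).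
  rewrite cardE; apply/perm_size/uniq_perm; rewrite ?enum_uniq // => x.
  by rewrite mem_enum wsP.
by rewrite size_flatten sumnE big_map.
Qed.

Lemma link_symbol_top (X : wlink Q) :
  narrows_lt (narrows (forget_wlink X)) (link_symbol R (val X) - << forget_wlink X >>).
Proof.
have [T [lab [ht [P [f [ws [s mX]]]]]]] := model_exists_finType (valP X).
have [E En] := model_forget mX; have [X1 sp co ps ss] := mX.
rewrite En (model_symbol R mX) -E.
have -> : #|P| = (narrows (vertex_monom (val X).2) + #|P :\: (f, set0).2|)%N.
  rewrite /vertex_monom narrows_prod big1 => [|v _]; last exact: narrowsU.
  by rewrite [(_, _).2]/= setD0.
have sP : {subset s <= P} by move=> x; rewrite (model_mem mX).
exact: symbol_top co sP.
Qed.

Lemma hlink_symbol_top (X : hlink Q) :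
  narrows_lt (narrows (forget X)) (hlink_symbol R X - << forget X >>).
Proof. exact: link_symbol_top. Qed.

Lemma prod_ucmE (bs : seq (Lbasis Q)) b :
  (\big[mmul/mone]_(c <- bs) ucm c : {cmonom Lbasis Q}) b = count_mem b bs.
Proof.
elim: bs => [|c bs IH]; first by rewrite big_nil cm1.
by rewrite big_cons cmM cmU IH.
Qed.

Lemma prod_ucm_exists (m : {cmonom Lbasis Q}) :
  exists bs, \big[mmul/mone]_(c <- bs) ucm c = m.
Proof.
exists (flatten [seq nseq (m b) b | b <- finsupp m]).
apply/eqP/cmP => b; rewrite prod_ucmE count_flatten -map_comp sumnE big_map.
under eq_bigr => c _ do rewrite /= count_nseq /=.
have [bm|nbm] := boolP (b \in finsupp m); last first.
  move: (nbm); rewrite -cmE_eq0 => /eqP->; apply: big1_seq => c /= cm.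
  by case: eqVneq cm => // -> cm; rewrite cm in nbm.
rewrite (bigD1_seq b) ?fset_uniq //= eqxx mul1n big1 ?addn0 // => c.
by move/negPf=> ->.
Qed.

Lemma link_exists (bs : seq (Lbasis Q)) :
  exists2 X : prelink Q, link_wf X
    & \big[mmul/mone]_(b <- components X) ucm b = \big[mmul/mone]_(b <- bs) ucm b.
Proof.
elim: bs => [|b bs [X wX EX]].
  by exists ([::], [::]); rewrite // /components /= big_nil.
rewrite big_cons -EX; case: b => [c|v]; last first.
  exists (X.1, v :: X.2) => //; rewrite !components_monom /vertex_monom big_cons.
  by rewrite !mulmA; congr mmul; rewrite mulmC.
pose w := repr (val c).
(* The new word receives consecutive heights from [N] on, all above those of [X]. *)
have [N ltN] : exists N, forall n, n \in heights X -> (n < N)%N.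
  exists (\max_(n <- heights X) n).+1 => n nX; rewrite ltnS.
  exact: (@leq_bigmax_seq _ (heights X) xpredT id).
have szl : (size w <= size (iota N (size w)))%N by rewrite size_iota.
have szr : (size (iota N (size w)) <= size w)%N by rewrite size_iota.
exists (zip w (iota N (size w)) :: X.1, X.2).
  have /andP[cl uh] := wX; apply/andP; split.
    by rewrite /= (unzip1_zip szl) cl andbT; exact: valP c.
  rewrite /heights /= map_cat -/(unzip2 _) (unzip2_zip szr) cat_uniq iota_uniq.
  apply/andP; split=> //; rewrite -/(heights X) uh andbT.
  apply/hasPn => n /ltN ltn; rewrite mem_iota negb_and -ltnNge.
  by rewrite ltn.
rewrite !components_monom /= big_cons (unzip1_zip szl) -!mulmA; congr mmul.
rewrite /necklace_monom; have -> : cyc w = val c by rewrite /cyc reprK.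
by rewrite valK.
Qed.

Lemma forget_surj (m : {cmonom Lbasis Q}) : exists X : hlink Q, forget X = m.
Proof.
have [bs <-] := prod_ucm_exists m; have [X wX <-] := link_exists bs.
by exists (\pi_(hlink Q) (Sub X wX : wlink Q)); rewrite forget_pi.
Qed.

(** A monomial determines the multiset of its factors. Well-formedness ensures that no word was
    dropped from [components]. *)
Lemma components_inj (X Y : prelink Q) : link_wf X -> link_wf Y ->
  \big[mmul/mone]_(b <- components X) ucm b
    = \big[mmul/mone]_(b <- components Y) ucm b ->
  perm_eq [seq cyc (unzip1 w) | w <- X.1] [seq cyc (unzip1 w) | w <- Y.1]
  /\ perm_eq X.2 Y.2.
Proof.
move=> wX wY E.
have pXY : perm_eq (components X) (components Y).
  by apply/allP => b _ /=; rewrite -!prod_ucmE E.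
pose getl (b : Lbasis Q) := if b is inl c then Some c else None.
pose getr (b : Lbasis Q) := if b is inr v then Some v else None.
have wordsE (Z : prelink Q) : link_wf Z ->
    map val (pmap getl (components Z)) = [seq cyc (unzip1 w) | w <- Z.1].
  move=> /andP[cl _]; rewrite /components pmap_cat.
  have -> : pmap getl [seq inr v | v <- Z.2] = [::].
    by elim: Z.2 => //=.
  rewrite cats0; elim: (Z.1) cl => //= w ws IH /andP[cw /IH{}IH].
  case: insubP => [c _ cE|] /=; last by rewrite closed_path_repr cw.
  by rewrite IH cE.
have vertsE (Z : prelink Q) : pmap getr (components Z) = Z.2.
  rewrite /components pmap_cat; set A := pmap _ _.
  have -> : A = [::] by rewrite /A; elim: (pmap insub _) => //=.
  by elim: Z.2 => //= v vs ->.
split; first by rewrite -!wordsE //; apply/perm_map/perm_pmap.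
by rewrite -(vertsE X) -(vertsE Y); apply: perm_pmap.
Qed.

End Forget.

(** * Reordering the heights *)

(** Insertion sort: each element is moved to its place by adjacent exchanges. *)
Lemma perm_eq_adjacent (T : eqType) (r : seq T -> seq T -> Prop) :
  (forall s, r s s) -> (forall s2 s1 s3, r s1 s2 -> r s2 s3 -> r s1 s3) ->
  (forall s1 p q s2, r (s1 ++ p :: q :: s2) (s1 ++ q :: p :: s2)) ->
  forall s s', perm_eq s s' -> r s s'.
Proof.
move=> r0 rT radj s s' pss.
(* The exchanges are given for whole lists, so the prefix already in place is carried along as
   [c]. *)
suff H c : r (c ++ s) (c ++ s') by apply: (H [::]).
elim: s s' pss c => [|x s IH] s' pss c.
  by move: pss; rewrite perm_sym => /perm_nilP ->.
have xs' : x \in s' by rewrite -(perm_mem pss) mem_head.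
case/splitPr: xs' pss => l t pss.
have pst : perm_eq s (l ++ t).
  by move: pss; rewrite perm_sym -cat1s perm_catCA /= perm_cons perm_sym.
apply: (rT (c ++ x :: l ++ t)); first by rewrite -!cat_rcons; apply: IH.
elim: l c {pss pst} => [|y l IHl] c /=; first exact: r0.
apply: rT (radj _ _ _ _) _.
by have := IHl (rcons c y); rewrite !cat_rcons.
Qed.

Lemma cyc_front (T : choiceType) (ws : seq (seq T)) p : p \in flatten ws ->
  exists w rest, perm_eq (map (@cyc T) ws) (map (@cyc T) ((p :: w) :: rest)).
Proof.
move=> /flattenP[w0 w0ws pw0]; have [i w wE] := rot_to pw0.
exists w, (rem w0 ws); rewrite (permPl (perm_map _ (perm_to_rem w0ws))) /= -wE.
rewrite (_ : cyc (rot i w0) = cyc w0) //.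
by apply/esym/eqP/cycP; exists i.
Qed.

(** The two outcomes are the normal forms in which the merging and the splitting relation are
    stated. *)
Lemma cyc_front2 (T : choiceType) (ws : seq (seq T)) p q :
  p \in flatten ws -> q \in flatten ws -> p != q ->
  exists w u rest ws', perm_eq (map (@cyc T) ws) (map (@cyc T) ws')
    /\ (ws' = (p :: w) :: (q :: u) :: rest \/ ws' = (p :: w ++ q :: u) :: rest).
Proof.
move=> /cyc_front[w [rest pw]]; rewrite (perm_mem (perm_flatten_cyc pw)) /= inE.
case: eqVneq => //= _; rewrite mem_cat => /orP[qw|/cyc_front[u [rest' pu]]] _.
  case/splitPr: qw pw => w1 u pw; exists w1, u, rest, ((p :: w1 ++ q :: u) :: rest).
  by split=> //; right.
exists w, u, rest', ((p :: w) :: (q :: u) :: rest'); split; last by left.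
by apply: perm_trans pw _; rewrite /= perm_cons.
Qed.

Lemma perm_cyc_map (T A : choiceType) (g : T -> A) (ws ws' : seq (seq T)) :
  perm_eq (map (@cyc T) ws) (map (@cyc T) ws') ->
  perm_eq (map (@cyc A) (map (map g) ws)) (map (@cyc A) (map (map g) ws')).
Proof.
move=> /(perm_map (fun c => cyc (map g (repr c)))); rewrite -!map_comp.
suff E : (fun c => cyc (map g (repr c))) \o (@cyc T) =1 (@cyc A) \o map g.
  by rewrite !(eq_map E).
move=> w /=; have /cycP[n En] : cyc w == cyc (repr (cyc w)) by rewrite {2}/cyc reprK.
by apply/eqP; rewrite eq_sym; apply/cycP; exists n; rewrite En map_rot.
Qed.

Lemma map_index_id (T : eqType) (s : seq T) : uniq s ->
  map (fun x => index x s) s = iota 0 (size s).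
Proof.
move=> us; apply: (@eq_from_nth _ 0%N); rewrite size_map ?size_iota // => i lti.
have [x0 _] : exists x0 : T, True by case: s us lti => // x; exists x.
by rewrite (nth_map x0) // index_uniq // nth_iota.
Qed.

Section Sorting.
Variables (R : realType) (Q : quiver).
Local Notation Ch := {poly R[i]}.

Section ModelTheory.
Variables (T : finType) (lab : T -> arrow Q) (P : {set T}) (f : {perm T}).
Implicit Types (ht : T -> nat) (s : seq T) (X Y : prelink Q).

Lemma model_cyc ht ws ws' s X : model lab ht P f ws s X ->
  perm_eq (map (@cyc T) ws) (map (@cyc T) ws') ->
  model lab ht P f ws' s (decorate lab ht ws', X.2)
  /\ link_equiv X (decorate lab ht ws', X.2).
Proof.
move=> [X1 sp co ps ss] pw; split.
  split=> //; first exact: spells_cyc sp.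
  exact: perm_trans ps (perm_flatten_cyc pw).
exists id; split=> //; rewrite X1 /=.
rewrite (eq_map (g := @cyc _)); first exact: perm_cyc_map.
by move=> w; rewrite /reheight (eq_map (g := id)) ?map_id // => -[].
Qed.

Lemma model_ltn ht ws s X x y : model lab ht P f ws s X -> x \in s -> y \in s ->
  (ht x < ht y)%N = (index x s < index y s)%N.
Proof.
move=> [_ _ _ _]; rewrite sorted_map => ss xs ys.
have tr : transitive (relpre ht ltn) by move=> a b c; apply: ltn_trans.
have lt_index := sorted_ltn_index tr ss.
case: (ltngtP (index x s) (index y s)) => h.
- exact: lt_index.
- by have /= lt_yx := lt_index _ _ ys xs h; rewrite ltnNge ltnW.
- by rewrite (_ : x = y) ?ltnn //; rewrite -(nth_index x xs) -(nth_index x ys) h.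
Qed.

Lemma model_equiv_order ht ht' ws s X Y :
  model lab ht P f ws s X -> model lab ht' P f ws s Y -> perm_eq X.2 Y.2 ->
  link_equiv X Y.
Proof.
move=> mX mY vXY; have [X1 _ _ ps _] := mX; have [Y1 _ _ _ _] := mY.
pose h n := nth 0%N (map ht' s) (index n (map ht s)).
have uh := model_uniq_heights mX.
have hE x : x \in s -> h (ht x) = ht' x.
  move=> xs; rewrite /h.
  have -> : index (ht x) (map ht s) = index x s.
    rewrite -{1}(nth_index x xs) -(nth_map x 0%N ht) ?index_mem //.
    by rewrite index_uniq // size_map index_mem.
  by rewrite (nth_map x) ?index_mem // nth_index.
exists h; split=> //.
  move=> a b; rewrite -!(perm_mem (model_heights mX)) => /mapP[x xs ->] /mapP[y ys ->].
  by rewrite !hE // (model_ltn mX) // (model_ltn mY).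
rewrite X1 Y1 /decorate -!map_comp.
rewrite (_ : map _ ws = map (fun w => cyc (map (fun x => (lab x, ht' x)) w)) ws) //.
apply/eq_in_map => w wws /=; congr cyc; rewrite /reheight -map_comp.
apply/eq_in_map => x xw /=; rewrite hE // (perm_mem ps).
by apply/flattenP; exists w.
Qed.

Lemma model_adjacent ht ws s1 s2 p q X :
  model lab ht P f ws (s1 ++ p :: q :: s2) X -> adjacent_heights X (ht p) (ht q).
Proof.
move=> mX; have [_ _ _ _] := mX; rewrite (sorted_pairwise ltn_trans) pairwise_map.
rewrite pairwise_cat /= => /and3P[/allrelP h12 _ /andP[/andP[lpq _] /andP[/allP hq _]]].
rewrite /adjacent_heights lpq; apply/allP => n.
rewrite -(perm_mem (model_heights mX)) => /mapP[x xs ->].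
move: xs; rewrite mem_cat !inE.
case/or4P=> [xs1|/eqP->|/eqP->|/hq/ltnW ->]; rewrite ?leqnn ?orbT //.
by have /= := h12 x p xs1 (mem_head _ _) => /ltnW->.
Qed.

(** Taking indices in [s] as heights realises any order of the letters by a link. *)
Lemma model_index ws s vs : spells P f ws -> coherent lab P (f, set0) ->
  perm_eq s (flatten ws) ->
  model lab (fun x => index x s) P f ws s (decorate lab (fun x => index x s) ws, vs).
Proof.
move=> sp co ps; split=> //; rewrite map_index_id; first exact: iota_ltn_sorted.
by have [uws _ _ _] := sp; rewrite (perm_uniq ps).
Qed.

End ModelTheory.

Lemma proj_relation g : link_relation g -> Alinks_proj Q R g = 0.
Proof.
move=> lg; apply/eqP; rewrite -(raddf0 (Alinks_proj Q R)); apply/modprojP.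
by rewrite subr0 -[g]scale1r -[1 *: g]addr0; apply: mspan_addZ => //; apply: mspan0.
Qed.

(* [D] will be the image of a section; modulo it, links can be reordered. *)
Variables (D : Alinks Q R -> Prop) (n : nat).
Hypothesis D0 : D 0.
Hypothesis DP : forall a u v, D u -> D v -> D (a *: u + v).
Local Notation proj_link X := (Alinks_proj Q R (hl R X)).
Hypothesis D_small : forall X, link_wf X -> (size (flatten X.1) < n)%N ->
  D (proj_link X).

Lemma D_hl X : (size (flatten X.1) < n)%N -> D (proj_link X).
Proof.
move=> ltX; have [wX|nX] := boolP (link_wf X); first exact: D_small.
by rewrite hl0 // raddf0.
Qed.

Lemma D_add u v : D u -> D v -> D (u + v).
Proof. by move=> Du Dv; rewrite -[u]scale1r; apply: DP. Qed.

Lemma D_scale a u : D u -> D (a *: u).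
Proof. by move=> Du; rewrite -[_ *: _]addr0; apply: DP. Qed.

Lemma proj_relation3 x y z (c : Ch) : link_relation (x - y - c *: z) ->
  Alinks_proj Q R x - Alinks_proj Q R y = c *: Alinks_proj Q R z.
Proof.
move=> /proj_relation /eqP; rewrite !linearB.
have -> : Alinks_proj Q R (c *: z) = c *: Alinks_proj Q R z by exact: linearZZ.
by rewrite subr_eq0 => /eqP.
Qed.

Lemma size_add_component (v : vertex Q) w (X : prelink Q) :
  size (flatten (add_component v w X).1) = (size w + size (flatten X.1))%N.
Proof. by case: w => //= p w; rewrite size_cat. Qed.

Lemma size_flatten_decorate (T : finType) (lab : T -> arrow Q) ht ws :
  size (flatten (decorate lab ht ws)) = size (flatten ws).
Proof. by rewrite /decorate -map_flatten size_map. Qed.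

(** By a relation, the difference is a multiple of a link with two arrows fewer, which [D] contains
    by hypothesis, or of 0 if that prelink is ill formed. *)
Lemma D_swap (T : finType) (lab : T -> arrow Q) ht (P : {set T}) f ws s1 s2 p q X :
  model lab ht P f ws (s1 ++ p :: q :: s2) X -> (size (flatten X.1) <= n)%N ->
  D (proj_link X - proj_link (decorate lab (ht \o tperm p q) ws, X.2)).
Proof.
move=> mX leX; have [pP qP npq _] := uniq_adjacent_mem mX.
have [X1 [_ wsP _ _] _ _ _] := mX; rewrite -!wsP in pP qP.
have [w [u [rest [ws' [pw ws'E]]]]] := cyc_front2 pP qP npq.
have mX' := model_swap X.2 mX.
have [mY eY] := model_cyc mX pw; have [mY' eY'] := model_cyc mX' pw.
rewrite (hl_equiv R (model_wf mX) (model_wf mY) eY).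
rewrite (hl_equiv R (model_wf mX') (model_wf mY') eY') /=.
have wY := model_wf mY; have adj := model_adjacent mY.
have uws' : uniq (flatten ws') by have [_ []] := mY.
have leY : (size (flatten (decorate lab ht ws')) <= n)%N.
  move: leX; rewrite X1 /decorate -!map_flatten !size_map.
  by rewrite (perm_size (perm_flatten_cyc pw)).
case: ws'E => ws'E; rewrite ws'E in wY adj uws' leY *.
  rewrite decorate_swap_merge //; have rel := link_merge R wY adj.
  rewrite (proj_relation3 rel); apply/D_scale/D_hl.
  move: leY; rewrite size_add_component !size_flatten_decorate /= !size_cat /=.
  by rewrite !size_cat !size_map; clear; lia.
rewrite decorate_swap_split //; move: wY adj leY.
rewrite size_flatten_decorate /= map_cat /= !size_cat /= => wY adj leY.
have rel := link_split R wY adj.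
rewrite (proj_relation3 rel); apply: D_scale.
set Z := hl R (add_component _ _ _).
have -> : Alinks_proj Q R (bracket Ch (lab p) (lab q) *: Z)
    = bracket Ch (lab p) (lab q) *: Alinks_proj Q R Z by exact: linearZZ.
apply/D_scale/D_hl; move: leY.
rewrite !size_add_component /= size_flatten_decorate !size_map.
by clear; lia.
Qed.

Lemma D_subT v u w : D (u - v) -> D (v - w) -> D (u - w).
Proof. by move=> uv vw; rewrite -(subrKA v); apply: D_add. Qed.

Lemma D_order (T : finType) (lab : T -> arrow Q) (P : {set T}) f ws vs s s' :
  spells P f ws -> coherent lab P (f, set0) -> perm_eq s (flatten ws) ->
  (size (flatten ws) <= n)%N -> perm_eq s s' ->
  D (proj_link (decorate lab (fun x => index x s) ws, vs)
     - proj_link (decorate lab (fun x => index x s') ws, vs)).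
Proof.
move=> sp co ps len pss'.
pose L s := proj_link (decorate lab (fun x => index x s) ws, vs).
(* The permutation is part of [r] so that, in a chain of exchanges, every intermediate list still
   enumerates the letters of [ws]. *)
pose r s s' := perm_eq s s' /\ (perm_eq s (flatten ws) -> D (L s - L s')).
suff [_] : r s s' by apply.
apply: (perm_eq_adjacent (r := r)) pss' => {s s' ps}.
- by move=> s; split=> // _; rewrite subrr.
- move=> s2 s1 s3 [p12 D12] [p23 D23]; split; first exact: perm_trans p12 p23.
  move=> p1; apply: (@D_subT (L s2)); first exact: D12.
  by apply: D23; rewrite -(permPl p12).
move=> s1 p q s2; have pm : perm_eq (s1 ++ p :: q :: s2) (s1 ++ q :: p :: s2).
  by apply/seq.permP => a; rewrite !count_cat /=; lia.
split=> // ps; have mX := model_index vs sp co ps.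
have mX' := model_swap vs mX.
have ps2 : perm_eq (s1 ++ q :: p :: s2) (flatten ws) by rewrite -(permPl pm).
have mY := model_index vs sp co ps2.
have eXY := model_equiv_order mX' mY (perm_refl _).
rewrite /L -(hl_equiv R (model_wf mX') (model_wf mY) eXY).
by apply: (D_swap mX); rewrite size_flatten_decorate.
Qed.

Lemma D_same X Y : link_wf X -> link_wf Y -> (size (flatten X.1) <= n)%N ->
  \big[mmul/mone]_(b <- components X) ucm b
    = \big[mmul/mone]_(b <- components Y) ucm b ->
  D (proj_link X - proj_link Y).
Proof.
move=> wX wY leX E; have [pw pv] := components_inj wX wY E.
have [T [lab [ht [P [f [ws [s mX]]]]]]] := model_exists_finType wX.
have [X1 sp co ps ss] := mX.
have pw' : perm_eq [seq cyc (map lab w) | w <- ws]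
    [seq cyc v | v <- map (@unzip1 _ _) Y.1].
  rewrite -map_comp; move: pw; rewrite X1 /decorate -map_comp; congr perm_eq.
  by apply: eq_map => w /=; rewrite /unzip1 -map_comp.
(* The arrows of [Y] are rewritten in the letters of [X]; its heights are then attached to these
   letters place by place as [ht']. *)
have [ws' Y1 pws] := lift_cyc pw'.
have sp' := spells_cyc pws sp; have [uws' _ _ _] := sp'.
have hY : heights Y = unzip2 (flatten Y.1) by [].
have shapeE : shape Y.1 = shape ws'.
  have := congr1 shape Y1; rewrite /shape -!map_comp.
  rewrite (eq_map (g := size)) => [->|w]; last by rewrite /= /unzip1 size_map.
  by apply: eq_map => w /=; rewrite size_map.
have sizeY : size (heights Y) = size (flatten ws').
  by rewrite hY /unzip2 size_map !size_flatten shapeE.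
pose ht' x := nth 0%N (heights Y) (index x (flatten ws')).
have ht'E : map ht' (flatten ws') = heights Y.
  apply: (@eq_from_nth _ 0%N); rewrite size_map ?sizeY // => i lti.
  have [x0 _] : exists x0 : T, True by case: (flatten ws') lti => // x; exists x.
  by rewrite (nth_map x0) // /ht' index_uniq.
have Y1' : Y.1 = decorate lab ht' ws'.
  rewrite -[LHS]flattenK -[RHS]flattenK /decorate -map_flatten.
  congr reshape.
    by rewrite shapeE /shape -map_comp; apply: eq_map => w /=; rewrite size_map.
  rewrite -zip_map ht'E hY -[LHS]zip_unzip; congr zip.
  by rewrite [RHS]map_flatten -Y1 /unzip1 map_flatten.
pose s' := sort (fun x y => ht' x <= ht' y)%N (flatten ws').
have ps' : perm_eq s' (flatten ws') by rewrite perm_sort.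
have mY : model lab ht' P f ws' s' Y.
  split=> //; rewrite ltn_sorted_uniq_leq; apply/andP; split.
    by rewrite (perm_uniq (perm_map ht' ps')) ht'E; case/andP: wY.
  by rewrite sorted_map; apply: sort_sorted => x y; apply: leq_total.
(* Both links are brought to the words [ws'] with indices as heights, so that they differ only in
   the order of the letters. *)
have mX2 := model_index X.2 sp co ps.
have mY2 := model_index X.2 sp' co ps'.
have [mX4 e24] := model_cyc mX2 pws.
have eX := link_equiv_trans (model_equiv_order mX mX2 (perm_refl _)) e24.
rewrite (hl_equiv R wX (model_wf mX4) eX).
have eY : link_equiv Y (decorate lab (fun x => index x s') ws', X.2).
  by apply: model_equiv_order mY mY2 _; rewrite perm_sym.
rewrite (hl_equiv R wY (model_wf mY2) eY).
apply: (D_order X.2 sp' co); first exact: perm_trans ps (perm_flatten_cyc pws).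
  by move: leX; rewrite X1 size_flatten_decorate (perm_size (perm_flatten_cyc pws)).
by rewrite (permPr ps'); apply: perm_trans ps (perm_flatten_cyc pws).
Qed.

End Sorting.

(** * The section over the monomials and the isomorphism *)

Section LinkSection.
Variables (R : realType) (Q : quiver).

Definition link_over (m : {cmonom Lbasis Q}) : hlink Q := sval (cid (forget_surj m)).

Lemma link_overK m : forget (link_over m) = m.
Proof. by rewrite /link_over; case: cid. Qed.

Definition link_section : {linear SLh Q R -> Alinks Q R} :=
  lin_ext (fun m => Alinks_proj Q R << link_over m >>).

Lemma hl_repr (X : hlink Q) : hl R (val (repr X)) = << X >> :> Atilde Q R.
Proof.
by rewrite (hlE R (valP (repr X))) (_ : Sub _ _ = repr X) ?reprK //; apply: val_inj.
Qed.

(** Induction on the number of arrows: modulo links with fewer arrows, [X] equals the chosen link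
    over the same monomial, which is a value of the section. *)
Lemma link_section_hl X : link_wf X ->
  exists x, link_section x = Alinks_proj Q R (hl R X).
Proof.
pose D u := exists x, link_section x = u.
have D0 : D 0 by exists 0; rewrite linear0.
have DP a u v : D u -> D v -> D (a *: u + v).
  by move=> [x <-] [y <-]; exists (a *: x + y); rewrite linearP.
have [n] := ubnP (size (flatten X.1)); elim: n X => // n IH X ltX wX.
have D_small Y : link_wf Y -> (size (flatten Y.1) < n)%N ->
    D (Alinks_proj Q R (hl R Y)).
  by move=> wY ltY; apply: IH.
pose m := \big[mmul/mone]_(b <- components X) ucm b.
have Em : link_section << m >> = Alinks_proj Q R (hl R (val (repr (link_over m)))).
  by rewrite hl_repr; apply: lin_extU.
have := D_same D0 DP D_small wX (valP (repr (link_over m))) ltX.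
case=> [|x Ex]; first by rewrite -[LHS]link_overK.
exists (x + << m >>); rewrite linearD Ex Em; exact: subrK.
Qed.

Lemma link_section_surj u : exists x, link_section x = u.
Proof.
have [y ->] := modproj_surj u; rewrite -[modproj _ y]/(Alinks_proj Q R y).
have -> : y = \sum_(k <- msupp y) y@_k *: (<< k >> : Atilde Q R) by exact: malg_sumU.
elim/big_rec: _ => [|k z _ [x Ex]]; first by exists 0; rewrite !linear0.
have [x' Ex'] := link_section_hl (valP (repr k)).
exists (y@_k *: x' + x); rewrite linearP Ex' Ex hl_repr.
by apply: esym; apply: linearP.
Qed.

Lemma quotient_symbol_top (X : hlink Q) :
  narrows_lt (narrows (forget X))
    (quotient_symbol R Q (Alinks_proj Q R << X >>) - pi_tilde (<< X >> : Atilde Q R)).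
Proof.
rewrite quotient_symbolE pi_tildeU.
have -> : symbol_map R Q << X >> = hlink_symbol R X by exact: lin_extU.
exact: hlink_symbol_top.
Qed.

Definition symbol_section : {linear SLh Q R -> SLh Q R} :=
  quotient_symbol R Q \o link_section.

Lemma symbol_section_tri m :
  narrows_lt (narrows m) (symbol_section << m >> - << m >>).
Proof.
have := @quotient_symbol_top (link_over m); rewrite pi_tildeU link_overK.
rewrite -[symbol_section _]/(quotient_symbol R Q (link_section << m >>)).
by rewrite [link_section _]lin_extU.
Qed.

Lemma symbol_section_inj : injective symbol_section.
Proof.
move=> x y E; apply/eqP; rewrite -subr_eq0; apply/eqP.
by apply: (unitri_inj symbol_section_tri); rewrite linearB E subrr.
Qed.

(** Injectivity comes from the composite with [quotient_symbol]. Hence no relation links the chosen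
    links, and their classes form a basis. *)
Lemma link_section_bij : bijective link_section.
Proof.
apply: bijective_of_inj_surj; last exact: link_section_surj.
by move=> x y E; apply: symbol_section_inj; rewrite /= E.
Qed.

(** Since the section is surjective, injectivity of the composite passes to its second factor;
    surjectivity passes to it in any case. *)
Lemma quotient_symbol_bij : bijective (quotient_symbol R Q).
Proof.
apply: bijective_of_inj_surj => [u v|y]; last first.
  by have [x <-] := unitri_surj symbol_section_tri y; exists (link_section x).
have [x <-] := link_section_surj u; have [y <-] := link_section_surj v.
by move=> E; congr (link_section _); apply: symbol_section_inj.
Qed.

End LinkSection.

Theorem theorem4p1 (R : realType) (Q : quiver) :
  [/\ free_module (Alinks Q R), free_module (SLh Q R)
    & exists Phi : {linear Alinks Q R -> SLh Q R},
        bijective Phi /\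
        forall X : hlink Q,
          narrows_lt (narrows (forget X))
            (Phi (Alinks_proj Q R << X >>) - pi_tilde (<< X >> : Atilde Q R))].
Proof.
split.
- by exists {cmonom Lbasis Q}, (link_section R Q); apply: link_section_bij.
- by exists {cmonom Lbasis Q}, (idfun : {linear SLh Q R -> SLh Q R}); exists id.
exists (quotient_symbol R Q); split; first exact: quotient_symbol_bij.
exact: quotient_symbol_top.
Qed.
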